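(* Let $A$ be an abelian group with $|A|<2^{\aleph_0}$. Then the following are equivalent: (1) $A$ is slender; (2) $A$ is n-slender; (3) $A$ is cm-slender; (4) $A$ is lcH-slender.
   Context: An abelian group $A$ is slender if for every homomorphism $\phi:\prod_{\mathbb{N}}\mathbb{Z}\to A$ there is $n\in\mathbb{N}$ with $\phi=\phi\circ p_n$, where $p_n:\prod_{\mathbb{N}}\mathbb{Z}\to\prod_{\mathbb{N}}\mathbb{Z}$ sends a sequence to the sequence agreeing with it in the first $n$ coordinates and zero elsewhere. Let $E=\bigcup_{n\in\mathbb{N}}C((0,\tfrac1n),\tfrac1n)\subseteq\mathbb{R}^2$ be the Hawaiian earring ($C(q,r)$ the circle of center $q$, radius $r$), and $\mathbb{H}=\pi_1(E,(0,0))$. For $N\in\mathbb{N}$ let $p_N:\mathbb{H}\to\mathbb{H}$ be the homomorphism induced by the retraction of $E$ onto the union of the first $N$ circles collapsing the other circles to the base point. A group $G$ is n-slender if for every homomorphism $\phi:\mathbb{H}\to G$ there is $N$ with $\phi=\phi\circ p_N$. A group is cm-slender if every homomorphism to it from a completely metrizable topological group has open kernel, and lcH-slender if every homomorphism to it from a locally compact Hausdorff topological group has open kernel. *)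

(* Defs.v *)
From HB Require Import structures.
From mathcomp Require Import all_boot all_order all_algebra.
From mathcomp Require Import all_classical all_reals all_analysis.
From mathcomp Require Import Rstruct Rstruct_topology.
Set Implicit Arguments. Unset Strict Implicit. Unset Printing Implicit Defensive.
Import Order.TTheory GRing.Theory Num.Theory.
Local Open Scope classical_set_scope.
Local Open Scope ring_scope.

Notation RR := Rdefinitions.R.

Definition trunc_seq (n : nat) (x : nat -> int) : nat -> int :=
  fun i => if (i < n)%N then x i else 0.

Definition slender (A : zmodType) : Prop :=
  forall phi : (nat -> int) -> A,
    (forall x y : nat -> int, phi (fun i => x i + y i) = phi x + phi y) ->
    exists n : nat, forall x, phi x = phi (trunc_seq n x).

Definition circle (n : nat) : set (RR * RR) :=
  [set p | p.1 ^+ 2 + (p.2 - (n%:R)^-1) ^+ 2 = ((n%:R)^-1) ^+ 2].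

Definition earring : set (RR * RR) :=
  [set p | exists n : nat, (0 < n)%N /\ circle n p].

Definition origin : RR * RR := (0, 0).

Definition I01 : set RR := [set t | 0 <= t <= 1].

Definition loop (g : RR -> RR * RR) : Prop :=
  {within I01, continuous g} /\ (forall t, I01 t -> earring (g t)) /\
  g 0 = origin /\ g 1 = origin.

Definition loop_homotopic (a b : RR -> RR * RR) : Prop :=
  exists H : RR * RR -> RR * RR,
    {within I01 `*` I01, continuous H} /\
    (forall s t, I01 s -> I01 t -> earring (H (s, t))) /\
    (forall t, I01 t -> H (0, t) = a t /\ H (1, t) = b t) /\
    (forall s, I01 s -> H (s, 0) = origin /\ H (s, 1) = origin).

Definition loop_concat (a b : RR -> RR * RR) : RR -> RR * RR :=
  fun t => if t <= 2^-1 then a (2 * t) else b (2 * t - 1).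

Definition retractN (N : nat) (p : RR * RR) : RR * RR :=
  if `[< exists n : nat, (0 < n <= N)%N /\ circle n p >] then p else origin.

(* A homomorphism pi_1(E,(0,0)) -> A is exactly a map on loops which is
   constant on homotopy classes and sends concatenation to the sum;
   phi o p_N corresponds to  phi (retractN N \o g). *)
Definition nslender (A : zmodType) : Prop :=
  forall phi : (RR -> RR * RR) -> A,
    (forall a b, loop a -> loop b -> loop_homotopic a b -> phi a = phi b) ->
    (forall a b, loop a -> loop b -> phi (loop_concat a b) = phi a + phi b) ->
    exists N : nat, forall g, loop g -> phi g = phi (retractN N \o g).

Definition is_topgroup (G : topologicalType) (mul : G -> G -> G) (inv : G -> G)
    (e : G) : Prop :=
  (forall x y z, mul x (mul y z) = mul (mul x y) z) /\
  (forall x, mul e x = x) /\ (forall x, mul x e = x) /\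
  (forall x, mul (inv x) x = e) /\ (forall x, mul x (inv x) = e) /\
  continuous (fun p : G * G => mul p.1 p.2) /\ continuous inv.

Definition completely_metrizable (G : topologicalType) : Prop :=
  exists d : G -> G -> RR,
    (forall x y, 0 <= d x y) /\ (forall x y, d x y = 0 <-> x = y) /\
    (forall x y, d x y = d y x) /\ (forall x y z, d x z <= d x y + d y z) /\
    (forall U : set G, open U <->
       (forall x, U x -> exists2 eps : RR, 0 < eps & [set y | d x y < eps] `<=` U)) /\
    (forall u : nat -> G,
       (forall eps : RR, 0 < eps -> exists N : nat, forall m n : nat,
          (N <= m)%N -> (N <= n)%N -> d (u m) (u n) < eps) ->
       exists l : G, forall eps : RR, 0 < eps -> exists N : nat, forall n : nat,
          (N <= n)%N -> d (u n) l < eps).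

Definition locally_compact_hausdorff (G : topologicalType) : Prop :=
  hausdorff_space G /\ (forall x : G, exists K : set G, compact K /\ nbhs x K).

Definition cmslender (A : zmodType) : Prop :=
  forall (G : topologicalType) (mul : G -> G -> G) (inv : G -> G) (e : G),
    is_topgroup mul inv e -> completely_metrizable G ->
    forall f : G -> A, (forall x y, f (mul x y) = f x + f y) ->
      open [set x | f x = 0].

Definition lcHslender (A : zmodType) : Prop :=
  forall (G : topologicalType) (mul : G -> G -> G) (inv : G -> G) (e : G),
    is_topgroup mul inv e -> locally_compact_hausdorff G ->
    forall f : G -> A, (forall x y, f (mul x y) = f x + f y) ->
      open [set x | f x = 0].

Definition card_lt_continuum (A : zmodType) : Prop :=
  card_le [set: A] [set: nat -> bool] /\ ~ card_le [set: nat -> bool] [set: A].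

(* Main.v *)
(* For |A| < 2^aleph_0 each of the four conditions is equivalent to: A is
   torsion-free and no nonzero element of A is divisible by every positive integer.

   Let A be torsion-free and reduced in this sense, and let f be a homomorphism
   violating one of the conditions.  It is nonzero on arbitrarily small elements
   x_n (sequences supported beyond n, loops in the circles beyond n, or elements of
   small neighbourhoods of the identity), and f(x_n) is not divisible by some
   m_n > 0.  When the x_n are small enough, every 0-1 sequence e has solutions of
   y_n = x_n^(e_n) y_(n+1)^(m_n).  Since |A| < 2^aleph_0, two sequences e give the
   same f(y_0); at the first place n where they differ, torsion-freeness gives
   f(x_n) in m_n A, a contradiction.  For loops one also needs, A being abelian,
   f(g) = f(p_N g) + f(q_N g), where q_N keeps the circles beyond N: a homotopy
   collapsing the lower halves of the first N circles makes g a finite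
   concatenation of loops in the first N circles and loops in the others.

   Conversely, if A has an element of prime order p or, being torsion-free, a
   nonzero divisible one, then extending partial homomorphisms by Zorn's lemma
   yields discontinuous homomorphisms from (Z/p)^N or R, both completely metrizable
   and locally compact, and a homomorphism from Z^N with the same nonzero value on
   all unit vectors.  The latter refutes slenderness, and also n-slenderness after
   composition with the winding numbers around the circles. *)

Require Import Defs.
From mathcomp Require Import all_boot all_order all_algebra.
From mathcomp Require Import all_classical all_reals all_analysis.
From mathcomp Require Import Rstruct Rstruct_topology.
From mathcomp Require Import zify ring lra.
Import Order.TTheory GRing.Theory Num.Theory numFieldNormedType.Exports.
Local Open Scope classical_set_scope.
Local Open Scope ring_scope.
Set Implicit Arguments. Unset Strict Implicit. Unset Printing Implicit Defensive.

(** * Torsion-free reduced groups and the counting argument *)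

Definition torsion_free_reduced (A : zmodType) : Prop :=
  (forall (a : A) n, (0 < n)%N -> a *+ n = 0 -> a = 0) /\
  (forall a : A, a <> 0 -> exists2 m, (0 < m)%N & forall b, a <> b *+ m).

(** [F e n] is the value of the [n]-th tail built from the 0-1 sequence [e]. Only the recursion
    between these values enters, so that sequences, topological groups and loops can all be treated
    by this statement. *)
Lemma no_branching (A : zmodType) :
  torsion_free_reduced A -> ~ card_le [set: nat -> bool] [set: A] ->
  forall (a : nat -> A) (m : nat -> nat) (F : (nat -> bool) -> nat -> A),
  (forall n, (0 < m n)%N) -> (forall n b, a n <> b *+ m n) ->
  ~ (forall e n, F e n = (if e n then a n else 0) + F e n.+1 *+ m n).
Proof.
move=> [tfA _] cA a m F m_gt0 am FE.
have [F0inj|] := pselect (injective (F^~ 0%N)).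
  apply: cA; have := @inj_card_eq _ _ [set: nat -> bool] (F^~ 0%N).
  move=> /(_ (in2W F0inj)) cE; rewrite -(card_le_eql cE).
  exact: subset_card_le.
apply: contra_notP => _ e1 e2 F12; apply/funext => i; apply/eqP.
(* Equality at index 0 persists as long as the sequences agree: cancel the common term, then divide
   by [m n]. *)
have F12n n : (forall k, (k < n)%N -> e1 k = e2 k) -> F e1 n = F e2 n.
  elim: n => [//|n IH] e12.
  have := IH (fun k kn => e12 k (ltnW kn)); rewrite (FE e1) (FE e2) e12// => /addrI F12m.
  apply/eqP; rewrite -subr_eq0; apply/eqP; apply: (tfA _ (m n)) => //.
  by rewrite mulrnBl F12m subrr.
elim/ltn_ind: i => i IH.
have E := F12n i (fun k ki => elimT eqP (IH k ki)); rewrite (FE e1) (FE e2) in E.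
(* Where exactly one sequence is true, [a i] would be a difference of two multiples of [m i]. *)
have sepa X Y : a i + X *+ m i <> Y *+ m i.
  by move=> aE; apply: (am i (Y - X)); rewrite mulrnBl -aE addrK.
move: E; case: (e1 i); case: (e2 i) => E; rewrite ?add0r in E; first exact: eqxx.
- by case: (sepa _ _ E).
- by case: (sepa _ _ (esym E)).
- exact: eqxx.
Qed.

Section Additive.
Variables (V A : zmodType) (f : V -> A).
Hypothesis fD : forall x y, f (x + y) = f x + f y.

Lemma hom0 : f 0 = 0.
Proof. by apply: (addrI (f 0)); rewrite -fD !addr0. Qed.

Lemma homN x : f (- x) = - f x.
Proof. by apply: (addrI (f x)); rewrite -fD !subrr hom0. Qed.

Lemma homMn x n : f (x *+ n) = f x *+ n.
Proof. by elim: n => [|n IH]; rewrite ?mulr0n ?hom0// !mulrS fD IH. Qed.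

End Additive.

(** * Extension of homomorphisms *)

Section HomExtension.
Variables (V A : zmodType) (D : set A).

(* [G] is the graph of a homomorphism from a subgroup of [V] to [D]. *)
Definition partial_hom (G : set (V * A)) : Prop :=
  [/\ G 0, forall u w, G u -> G w -> G (u - w),
      forall b, G (0, b) -> b = 0 & forall u, G u -> D u.2].

Lemma partial_homD G u w : partial_hom G -> G u -> G w -> G (u + w).
Proof.
move=> [G0 GB _ _] Gu Gw; rewrite -[w]opprK; apply: (GB) => //.
by rewrite -[- w]add0r; exact: GB.
Qed.

Hypothesis D0 : D 0.
Hypothesis DB : forall a b, D a -> D b -> D (a - b).

Lemma setMz (B : zmodType) (E : set B) (E0 : E 0)
  (EB : forall a b, E a -> E b -> E (a - b)) x n : E x -> E (x *~ n).
Proof.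
move=> Ex; have EN y : E y -> E (- y) by move=> Ey; rewrite -sub0r; exact: EB.
have En k : E (x *+ k).
  elim: k => [//|k IH]; rewrite mulrSr -[x in _ + x]opprK.
  exact/EB/EN.
by case: n => k; [exact: En|exact/EN/En].
Qed.

(** Zorn's lemma gives a maximal graph. The value [b] offered for [v] is compatible with all
    multiples of [v] in the domain, so adjoining [(v, b)] keeps the graph single-valued. Restricting
    values to [D] makes such a [b] available: [D] consists of the divisible elements in one
    application and of everything in the other. *)
Lemma hom_extend (G0 : set (V * A)) : partial_hom G0 ->
  (forall G, partial_hom G -> G0 `<=` G -> forall v, exists2 b, D b &
     forall n c, G (v *~ n, c) -> c = b *~ n) ->
  exists2 f : V -> A, (forall x y, f (x + y) = f x + f y) &
    forall u, G0 u -> f u.1 = u.2.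
Proof.
move=> pG0 step.
(* Taking the union with [G0] inside the predicate covers the empty chain too. *)
have [|X [pX Xmax]] := @Zorn_bigcup _ [set X | partial_hom (X `|` G0)].
  move=> F FP Ftot.
  have chain u w : (\bigcup_(X in F) X `|` G0) u -> (\bigcup_(X in F) X `|` G0) w ->
      (G0 u /\ G0 w) \/ exists2 X, F X & (X `|` G0) u /\ (X `|` G0) w.
    move=> [[X FX Xu]|G0u] [[Y FY Yw]|G0w].
    - have [XY|YX] := Ftot _ _ FX FY; right.
      + by exists Y => //; split; left => //; exact: XY.
      + by exists X => //; split; left => //; exact: YX.
    - by right; exists X => //; split; [left|right].
    - by right; exists Y => //; split; [right|left].
    - by left.
  have up X u : F X -> (X `|` G0) u -> (\bigcup_(X in F) X `|` G0) u.
    by move=> FX [Xu|]; [left; exists X|right].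
  have [G00 G0B G0f G0D] := pG0; split.
  - by right.
  - move=> u w Gu Gw; have [[? ?]|[X FX [Xu Xw]]] := chain _ _ Gu Gw.
      by right; exact: G0B.
    by apply: (up X) => //; have [_ XB _ _] := FP _ FX; exact: XB.
  - move=> b Gb; have [[? _]|[X FX [Xu _]]] := chain _ _ Gb Gb; first exact: G0f.
    by have [_ _ Xf _] := FP _ FX; exact: Xf.
  - move=> u Gb; have [[? _]|[X FX [Xu _]]] := chain _ _ Gb Gb; first exact: G0D.
    by have [_ _ _ XD] := FP _ FX; exact: XD.
set G := X `|` G0 in pX.
have [GO GB Gf GD] := pX.
have G0G : G0 `<=` G by move=> u; right.
have total v : exists b, G (v, b).
  have [b Db bE] := step _ pX G0G v.
  (* The subgroup generated by [G] and [(v, b)]. *)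
  pose G' := [set u | exists n w, G w /\ u = w + (v *~ n, b *~ n)] : set (V * A).
  have GG' : G `<=` G'.
    by move=> u Gu; exists 0, u; rewrite !mulr0z addr0.
  have pG' : partial_hom G'.
    split.
    - exact: GG'.
    - move=> _ _ [n [w [Gw ->]]] [n' [w' [Gw' ->]]].
      exists (n - n'), (w - w'); split; first exact: GB.
      rewrite opprD addrACA; congr (_ + _).
      by rewrite !mulrzBr.
    - move=> c [n [[w1 w2] [Gw [w1E ->]]]].
      have {}w1E : w1 = v *~ - n.
        by rewrite mulrNz; apply/eqP; rewrite -addr_eq0 -w1E.
      by rewrite w1E in Gw; rewrite (bE _ _ Gw) mulrNz addNr.
    - move=> _ [n [w [Gw ->]]] /=.
      have DN y : D y -> D (- y) by move=> Dy; rewrite -sub0r; exact: DB.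
      rewrite -[_ *~ n]opprK; apply: DB; first exact: GD.
      by apply: DN; exact: setMz.
  have G'X : G' `<=` X.
    apply: contrapT => nG'X; apply: (Xmax G').
      rewrite properEneq; split; last by move=> u Xu; apply: GG'; left.
      by apply/eqP => XG'; apply: nG'X; rewrite XG'.
    by rewrite /= setUidl// => u /G0G /GG'.
  exists b; left; apply: G'X; exists 1, 0; split => //.
  by rewrite add0r !mulr1z.
have [f fG] := choice total.
have fE v b : G (v, b) -> f v = b.
  move=> Gvb; apply/eqP; rewrite -subr_eq0; apply/eqP/Gf.
  by rewrite -(subrr v); exact: (GB _ _ (fG v) Gvb).
exists f => [x y|[v b] /G0G]; last exact: fE.
by apply: fE; exact: (partial_homD pX (fG x) (fG y)).
Qed.

End HomExtension.

(** * Divisibility, torsion and homomorphisms on integer sequences *)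

Definition divisible_elt (A : zmodType) : set A :=
  [set a | forall m, (0 < m)%N -> exists b, a = b *+ m].

Definition eseq (n : nat) : nat -> int := fun i => (i == n)%:R.

Lemma not_torsion_free_reduced (A : zmodType) : ~ torsion_free_reduced A ->
  (exists p (a : A), [/\ prime p, a <> 0 & a *+ p = 0]) \/
  ((forall (a : A) n, (0 < n)%N -> a *+ n = 0 -> a = 0) /\
   exists2 a : A, a <> 0 & divisible_elt a).
Proof.
move=> nA; have [tfA|ntfA] := pselect (forall (a : A) n, (0 < n)%N -> a *+ n = 0 -> a = 0).
  right; split => //; apply: contrapT => ndiv; apply: nA; split => // a a0.
  apply: contrapT => nm; apply: ndiv; exists a => // m m0.
  by apply: contrapT => nb; apply: nm; exists m => // b ab; apply: nb; exists b.
left; apply: contrapT => np; apply: ntfA => a n.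
elim/ltn_ind: n a => n IH a n0 an.
have [n1|n1] := leqP n 1; first by move: an; have -> : n = 1%N by lia.
apply: contrapT => a0.
(* Induction makes [a *+ p], killed by [n %/ p], zero; a nonzero [a] would then have prime order. *)
pose p := pdiv n; have pp : prime p by exact: pdiv_prime.
have nE : n = (n %/ p * p)%N by rewrite divnK// pdiv_dvd.
have np0 : (0 < n %/ p)%N by move: n0; rewrite [X in (0 < X)%N]nE; case: (n %/ p)%N.
have ap : a *+ p <> 0 by move=> ap; apply: np; exists p, a.
apply: ap; apply: (IH (n %/ p)%N) => //; last by rewrite -mulrnA mulnC -nE.
by rewrite ltn_Pdiv// prime_gt1.
Qed.

Lemma pairMz (V A : zmodType) (u : V * A) (k : int) :
  u *~ k = (u.1 *~ k, u.2 *~ k).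
Proof.
have pairMn j : u *+ j = (u.1 *+ j, u.2 *+ j).
  by elim: j => [|j IHj]; [case: u|rewrite !mulrS IHj].
by case: k => k; rewrite /intmul pairMn.
Qed.

(** If a nonzero multiple [v *~ n] has a value [c], the value at [v] must be [c] divided by [n].
    Torsion-freeness makes this quotient unique, hence again divisible and compatible with the other
    multiples of [v]. If there is no such multiple, 0 will do. *)
Lemma divisible_extend (V A : zmodType) (G0 : set (V * A)) :
  (forall (a : A) n, (0 < n)%N -> a *+ n = 0 -> a = 0) ->
  partial_hom (@divisible_elt A) G0 ->
  exists2 f : V -> A, (forall x y, f (x + y) = f x + f y) &
    forall u, G0 u -> f u.1 = u.2.
Proof.
move=> tfA pG0.
have tfz (a : A) (n : int) : n != 0 -> a *~ n = 0 -> a = 0.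
  case: n => n n0 /=; first by apply: tfA; rewrite lt0n.
  by rewrite NegzE mulrNz => /eqP; rewrite oppr_eq0 => /eqP; exact: tfA.
have D0 : divisible_elt (0 : A) by move=> m _; exists 0; rewrite mul0rn.
apply: (hom_extend D0 _ pG0).
  move=> a b Da Db m m0; have [[a' ->] [b' ->]] := (Da _ m0, Db _ m0).
  by exists (a' - b'); rewrite mulrnBl.
move=> G pG _ v.
have [[n [c [n0 Gnc]]]|nG] := pselect (exists n c, n != 0 /\ G (v *~ n, c)); last first.
  exists 0 => // n c Gnc; have [n0|n0] := eqVneq n 0; last first.
    by exfalso; apply: nG; exists n, c.
  have [_ _ Gf _] := pG; move: Gnc; rewrite n0 mulr0z => /Gf ->.
  by rewrite mulr0z.
have [GO GB Gf GD] := pG.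
have [b Db bE] : exists2 b, divisible_elt b & c = b *~ n.
  have [b bE] : exists b, c = b *~ n.
    have /(_ `|n|%N) [|b /= bE] := GD _ Gnc; first by rewrite absz_gt0.
    move: bE; case: (intP n) n0 => // k _ bE; first by exists b.
    by exists (- b); rewrite mulrNz mulNrz opprK.
  (* Dividing [c] by [n * m] and comparing with the unique quotient by [n] shows that [b] is a
     multiple of [m]. *)
  exists b => // m m0; have /(_ (`|n| * m)%N) [|d /= dE] := GD _ Gnc.
    by rewrite muln_gt0 absz_gt0 n0.
  have [d' d'E] : exists d', c = d' *+ m *~ n.
    move: dE; case: (intP n) n0 => // k _ dE.
      by exists d; rewrite dE mulnC mulrnA.
    by exists (- d); rewrite dE mulrNz mulNrn mulNrz opprK mulnC mulrnA.
  exists d'; apply/eqP; rewrite -subr_eq0; apply/eqP/(tfz _ n) => //.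
  by rewrite mulrzBl -bE -d'E subrr.
exists b => // n' c' Gn'.
(* The element [v *~ (n * n')] receives a value from either relation. *)
have: G (0, c *~ n' - c' *~ n).
  have := GB _ _ (setMz GO GB n' Gnc) (setMz GO GB n Gn').
  rewrite !pairMz /=; congr G; congr pair.
  by rewrite -!mulrzA mulrC subrr.
move=> /Gf/eqP; rewrite subr_eq0 => /eqP E.
apply/eqP; rewrite -subr_eq0; apply/eqP/(tfz _ n) => //.
by rewrite mulrzBl -E bE -!mulrzA mulrC subrr.
Qed.

Lemma sum_eseq n k : (n < k)%N -> \sum_(i < k) eseq n i = 1.
Proof.
move=> nk; rewrite (bigD1 (Ordinal nk))//= /eseq eqxx big1 ?addr0// => i.
by rewrite -val_eqE /= => /negPf ->.
Qed.

(* With [p = 0] the first condition says that [u.1] has finite support. *)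
Definition finsupp_graph (A : zmodType) (p : nat) (a : A) :
    set ((nat -> int) * A) :=
  [set u | exists n, forall k, (n <= k)%N ->
     (p%:Z %| u.1 k)%Z /\ u.2 = a *~ \sum_(i < k) u.1 i].

Lemma finsupp_graph_eseq (A : zmodType) p (a : A) n : finsupp_graph p a (eseq n, a).
Proof.
exists n.+1 => k nk /=; rewrite sum_eseq// mulr1z; split=> //.
by rewrite /eseq gtn_eqF// dvdz0.
Qed.

Lemma finsupp_graph_partial_hom (A : zmodType) (D : set A) p (a : A) :
  D 0 -> (forall a b, D a -> D b -> D (a - b)) -> D a ->
  partial_hom D (finsupp_graph p a).
Proof.
move=> D0 DB Da; split.
- by exists 0%N => k _; rewrite /= dvdz0 big1.
- move=> u w [n un] [n' wn]; exists (maxn n n') => k; rewrite geq_max => /andP[nk nk'].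
  have [[pu u2] [pw w2]] := (un _ nk, wn _ nk').
  by rewrite /= u2 w2 -mulrzBr -sumrB; split => //; rewrite rpredB.
- by move=> b [n] /(_ n (leqnn n))[_ /=]; rewrite big1.
- by move=> u [n] /(_ n (leqnn n))[_ ->]; exact: setMz.
Qed.

Lemma divisible_seq_hom (A : zmodType) (a : A) :
  (forall (a : A) n, (0 < n)%N -> a *+ n = 0 -> a = 0) -> divisible_elt a ->
  exists2 f : (nat -> int) -> A, (forall x y, f (x + y) = f x + f y) &
    forall n, f (eseq n) = a.
Proof.
move=> tfA Da; have [|f fD fE] := @divisible_extend _ _ (finsupp_graph 0 a) tfA.
  apply: finsupp_graph_partial_hom => //.
    by move=> m _; exists 0; rewrite mul0rn.
  move=> b c Db Dc m m0; have [[b' ->] [c' ->]] := (Db _ m0, Dc _ m0).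
  by exists (b' - c'); rewrite mulrnBl.
by exists f => // n; exact: (fE _ (finsupp_graph_eseq 0 a n)).
Qed.

(** The graph sends all multiples of [p] to 0, so the extension is one of vector spaces over the
    field with [p] elements: a multiple of [v] in the domain is either a multiple of [v *+ p] or
    brings in [v] itself. *)
Lemma torsion_seq_hom (A : zmodType) p (a : A) : prime p -> a *+ p = 0 ->
  exists2 f : (nat -> int) -> A, (forall x y, f (x + y) = f x + f y) &
    (forall n, f (eseq n) = a) /\ forall x, f (x *+ p) = 0.
Proof.
move=> pp ap.
have pG0 (x : nat -> int) : finsupp_graph p a (x *+ p, 0).
  have xpE k : (x *+ p) k = x k * p%:Z by rewrite natmulfctE -mulr_natr natz.
  exists 0%N => k _ /=; rewrite xpE dvdz_mull//; split=> //.
  under eq_bigr do rewrite xpE.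
  by rewrite -mulr_suml mulrC mulrzA -pmulrn ap mul0rz.
have [//|//||G pG G0G v|f fD fE] := @hom_extend _ A setT _ _ (finsupp_graph p a).
- exact: finsupp_graph_partial_hom.
- have [GO GB Gf _] := pG.
  have [[b Gb]|nG] := pselect (exists b, G (v, b)).
    exists b => // n c Gnc; have := GB _ _ Gnc (setMz GO GB n Gb).
    rewrite pairMz => Gc; apply/eqP; rewrite -subr_eq0; apply/eqP/Gf.
    by move: Gc; congr G; congr pair; exact: subrr.
  exists 0 => // n c Gnc; rewrite mul0rz.
  have [/dvdzP[q nE]|pn] := boolP (p%:Z %| n)%Z.
    have := GB _ _ Gnc (G0G _ (pG0 (v *~ q))).
    rewrite nE mulrzA -pmulrn => Gc; apply: Gf; move: Gc.
    by congr G; congr pair; [exact: subrr|exact: subr0].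
  (* A Bezout relation between [n] and [p] puts [v] into the domain, against [nG]. *)
  have : coprimez n p by rewrite coprimez_sym coprimezE prime_coprime.
  move=> /coprimezP[[u w] /= uw]; exfalso; apply: nG; exists (c *~ u).
  have := partial_homD pG (setMz GO GB u Gnc) (setMz GO GB w (G0G _ (pG0 v))).
  rewrite !pairMz /= pmulrn -!mulrzA; congr G; congr pair.
    by rewrite /= -mulrzDr mulrC [p%:Z * w]mulrC uw mulr1z.
  by rewrite /= mul0rz; exact: addr0.
- exists f => //; split=> [n|x]; first exact: (fE _ (finsupp_graph_eseq p a n)).
  exact: (fE _ (pG0 x)).
Qed.

Lemma not_tfr_seq_hom (A : zmodType) : ~ torsion_free_reduced A ->
  exists2 a : A, a <> 0 &
  exists2 f : (nat -> int) -> A, (forall x y, f (x + y) = f x + f y) &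
    forall n, f (eseq n) = a.
Proof.
move=> /not_torsion_free_reduced[[p [a [pp a0 ap]]]|[tfA [a a0 Da]]]; exists a => //.
  by have [f fD [fe _]] := torsion_seq_hom pp ap; exists f.
exact: divisible_seq_hom.
Qed.

(** * Slender groups *)

Lemma slender_tfr (A : zmodType) : slender A -> torsion_free_reduced A.
Proof.
move=> slA; apply: contrapT => /not_tfr_seq_hom[a a0 [f fD fe]].
(* [eseq n] is the first unit vector that [trunc_seq n] kills. *)
have [n fn] := slA f fD; apply: a0; rewrite -(fe n) fn -(hom0 fD); congr f.
by apply/funext => i; rewrite /trunc_seq /eseq; case: ltngtP.
Qed.

(** The sequences [x n] vanish below [n], so the infinite sum that solves the recursion is finite in
    each coordinate. *)
Lemma tfr_slender (A : zmodType) : torsion_free_reduced A ->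
  ~ card_le [set: nat -> bool] [set: A] -> slender A.
Proof.
move=> tA cA f fD; apply: contrapT => nf.
have xP n : exists x, f (x - trunc_seq n x) <> 0.
  apply: contrapT => nx; apply: nf; exists n => x; apply: contrapT => fx.
  apply: nx; exists x => E; apply: fx.
  by apply/eqP; rewrite -subr_eq0 -(homN fD) -fD E.
have [x0 fx0] := choice xP.
pose x n := x0 n - trunc_seq n (x0 n).
have x_lt n i : (i < n)%N -> x n i = 0.
  by move=> ni; rewrite /x -[LHS]/(x0 n i - trunc_seq n (x0 n) i) /trunc_seq ni subrr.
have mP n : exists m, (0 < m)%N /\ forall b, f (x n) <> b *+ m.
  by have [_ /(_ _ (fx0 n))[m m0 mb]] := tA; exists m.
have [m /all_and2[m0 fm]] := choice mP.
(* [Y e k n] adds up [k] terms from index [n] on. Coordinate [i] sees only the terms [n] to [i],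
   whence the count [i.+1 - n] in [y]. *)
pose fix Y (e : nat -> bool) (k n i : nat) {struct k} : int :=
  if k is k'.+1 then (if e n then x n i else 0) + Y e k' n.+1 i *+ m n else 0.
pose y e n i := Y e (i.+1 - n)%N n i.
have yE e n : y e n = (if e n then x n else 0) + y e n.+1 *+ m n.
  apply/funext => i; rewrite natmulfctE fctE /y subSS.
  have [ni|ni] := leqP n i; first by rewrite subSn//=; case: (e n).
  have -> : (i.+1 - n = 0)%N by apply/eqP; rewrite subn_eq0.
  have -> : (i - n = 0)%N by apply/eqP; rewrite subn_eq0 ltnW.
  by rewrite /= mul0rn addr0; case: (e n) => //; rewrite x_lt.
apply: (no_branching tA cA m0 fm (F := fun e n => f (y e n))) => e n.
rewrite {1}yE fD (homMn fD); congr (_ + _).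
by case: (e n) => //; exact: hom0.
Qed.

(** * Topological groups *)

Lemma fmap_ultra (T U : Type) (h : T -> U) (F : set_system T) :
  UltraFilter F -> UltraFilter (h @ F).
Proof.
move=> FU; split; first exact: fmap_proper_filter.
move=> H HP FH; apply/seteqP; split; last exact: FH.
move=> B HB; have [//|FB] := in_ultra_setVsetC (h @^-1` B) FU.
have HBC : H (~` B) by exact: FH.
by have [x []] := filter_ex (filterI HB HBC).
Qed.

Section BranchingGroup.
Variables (G : topologicalType) (mul : G -> G -> G) (inv : G -> G) (e : G).
Hypothesis grp : is_topgroup mul inv e.

Fixpoint gpow (x : G) (n : nat) : G := if n is n'.+1 then mul x (gpow x n') else e.

Lemma gpow_continuous n : continuous (gpow^~ n).
Proof.
have [_ [_ [_ [_ [_ [mulC _]]]]]] := grp.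
elim: n => [|n IH] x; first exact: cvg_cst.
apply: (@cvg_comp _ _ _ (fun y => (y, gpow y n)) (fun p => mul p.1 p.2) _ (nbhs (x, gpow x n))) => //.
  by apply: cvg_pair => //; exact: IH.
exact: (mulC (x, gpow x n)).
Qed.

Lemma gpow1 n : gpow e n = e.
Proof. by have [_ [mul1 _]] := grp; elim: n => [//|n IH] /=; rewrite IH mul1. Qed.

Lemma mull_continuous x : continuous (mul x).
Proof.
have [_ [_ [_ [_ [_ [mulC _]]]]]] := grp.
move=> y; apply: (@cvg_comp _ _ _ (fun y => (x, y)) (fun p => mul p.1 p.2) _ (nbhs (x, y))) => //.
  by apply: cvg_pair => //; exact: cvg_cst.
exact: (mulC (x, y)).
Qed.

Definition branch (x : G) (m : nat) (b : bool) (y : G) : G :=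
  mul (if b then x else e) (gpow y m).

Lemma branch_continuous x m b : continuous (branch x m b).
Proof.
move=> y; apply: (@cvg_comp _ _ _ (gpow^~ m) (mul (if b then x else e))).
  exact: gpow_continuous.
exact: mull_continuous.
Qed.

Variables (A : zmodType) (f : G -> A).
Hypothesis fM : forall x y, f (mul x y) = f x + f y.

Lemma gmorph1 : f e = 0.
Proof. by have [_ [mul1 _]] := grp; apply: (addrI (f e)); rewrite -fM mul1 addr0. Qed.

Lemma gmorph_pow x n : f (gpow x n) = f x *+ n.
Proof. by elim: n => [|n IH] /=; rewrite ?gmorph1// fM IH mulrS. Qed.

Lemma gmorph_branch x m b y :
  f (branch x m b y) = (if b then f x else 0) + f y *+ m.
Proof. by rewrite /branch fM gmorph_pow; case: b; rewrite ?gmorph1. Qed.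

Lemma kernel_openP : nbhs e [set x | f x = 0] -> open [set x | f x = 0].
Proof.
have [mulA [mul1 [_ [mulV [mulrV _]]]]] := grp.
move=> ne; rewrite openE => x /= fx.
have C : mul (inv x) y @[y --> x] --> e.
  by rewrite -[X in _ --> X](mulV x); exact: mull_continuous.
apply: (@filterS _ (nbhs x) _ _ _ _ (C _ ne)) => y /=.
by rewrite fM (_ : f (inv x) = 0) ?add0r// -[LHS]addr0 -fx -fM mulV gmorph1.
Qed.

(* [small] abstracts the two completeness properties used: "of diameter at most
   1/n" in a complete metric group, "inside a compact set" in a locally compact
   one. *)
Variable small : nat -> set G -> Prop.
Hypothesis hG : hausdorff_space G.
Hypothesis small_nbhs : forall n (x : G), exists2 U, nbhs x U & small n U.
Hypothesis smallS : forall n S S', S' `<=` S -> small n S -> small n S'.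
Hypothesis small_le : forall n n' S, (n <= n')%N -> small n' S -> small n S.
Hypothesis small_cvg : forall F : set_system G, UltraFilter F ->
  (forall n, exists2 S, F S & small n S) -> exists x : G, F --> x.

(* Stands for finiteness of [M] when intersecting neighbourhoods of [e]. *)
Definition finitary (M : set (G -> G)) := forall B : (G -> G) -> set G,
  (forall h, M h -> nbhs e (B h)) -> exists2 U, nbhs e U & forall h, M h -> U `<=` B h.

(* [st_M] collects the composites of the branching maps chosen so far along all
   0-1 sequences, starting at any previous stage. *)
Record stage := Stage {
  st_x : G; st_m : nat; st_M : set (G -> G); st_U : set G }.

(** Later partial products are images of points of [st_U s] under these composites. The last clause
    confines them to a small set, which makes them converge. *)
Definition good_stage n (s : stage) := [/\ open_nbhs e (st_U s),
  finitary (st_M s), (forall h, st_M s h -> continuous h) &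
  forall h, st_M s h -> small n (h @` st_U s)].

Definition good_elt (s : stage) :=
  [/\ st_U s (st_x s), (0 < st_m s)%N & forall b, f (st_x s) <> b *+ st_m s].

Definition next_stage (s s' : stage) :=
  (forall b, branch (st_x s) (st_m s) b @` st_U s' `<=` st_U s) /\
  st_M s' = [set h | h = id \/
    exists2 h', st_M s h' & exists b, h = h' \o branch (st_x s) (st_m s) b].

Hypothesis tfA : torsion_free_reduced A.
Hypothesis nfker : ~ nbhs e [set x | f x = 0].

Lemma stage_elt U : nbhs e U -> exists x m,
  [/\ U x, (0 < m)%N & forall b, f x <> b *+ m].
Proof.
move=> eU; have [x Ux fx] : exists2 x, U x & f x <> 0.
  apply: contrapT => nx; apply: nfker; apply: filterS eU => x Ux /=.
  by apply: contrapT => fx; apply: nx; exists x.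
by have [_ /(_ _ fx)[m m0 mb]] := tfA; exists x, m.
Qed.

Lemma finitary_small n M : finitary M -> (forall h, M h -> continuous h) ->
  exists2 U, nbhs e U & forall h, M h -> small n (h @` U).
Proof.
move=> fM' cM.
have [V V1 V2] : exists2 V : G -> set G, forall x : G, nbhs x (V x) & forall x, small n (V x).
  have VP (x : G) : exists V : set G, nbhs x V /\ small n V.
    by have [V ? ?] := small_nbhs n x; exists V.
  by have [V {}VP] := choice VP; exists V => x; have [] := VP x.
have [|U eU UM] := fM' (fun h => h @^-1` V (h e)).
  by move=> h Mh; apply: (cM h Mh e); exact: V1.
exists U => // h Mh; apply: smallS (V2 (h e)).
by move=> _ [x Ux <-]; exact: UM Ux.
Qed.

(** The order of choices is: the new composites; a neighbourhood that each of them maps to a small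
    set and both branches map into the old neighbourhood; and last an element of it with its
    exponent. *)
Lemma next_stageP n s : good_stage n s -> good_elt s ->
  exists2 s', next_stage s s' & good_stage n.+1 s' /\ good_elt s'.
Proof.
move=> [eU fM' cM _] [Ux m0 _].
have [mulA [mul1 [mulr1 _]]] := grp.
pose br := branch (st_x s) (st_m s).
pose M' := [set h | h = id \/ exists2 h', st_M s h' & exists b, h = h' \o br b].
(* A condition on [M'] amounts to one on [id] and two on [st_M s], one for each branch. *)
have fM1 : finitary M'.
  move=> B eB.
  have [|V eV VB] := fM' (fun h => B (h \o br false) `&` B (h \o br true)).
    move=> h Mh; apply: filterI; apply: eB; right; exists h => //; by eexists.
  exists (V `&` B id); first by apply: filterI => //; apply: eB; left.
  move=> h [->|[h' Mh' [b ->]]] x [Vx Bx] //.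
  by have [] := VB h' Mh' x Vx; case: b.
have cM1 h : M' h -> continuous h.
  move=> [->|[h' Mh' [b ->]]] x; first exact: cvg_id.
  by apply: continuous_comp; [exact: branch_continuous|exact: cM].
have [V eV VM] := finitary_small n.+1 fM1 cM1.
have [W eW WU] : exists2 W, nbhs e W & forall b, br b @` W `<=` st_U s.
  have eb b : nbhs e (br b @^-1` st_U s).
    have C : br b y @[y --> e] --> (if b then st_x s else e).
      rewrite [X in _ --> X](_ : _ = br b e); first exact: branch_continuous.
      by rewrite /br /branch gpow1 mulr1.
    apply: C; apply: open_nbhs_nbhs; split; first by case: eU.
    by case: b => //; case: eU.
  exists (br true @^-1` st_U s `&` br false @^-1` st_U s); first exact: filterI.
  by move=> b _ [y [/= y1 y2] <-]; case: b.
pose U' := interior (V `&` W).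
have U'VW : U' `<=` V `&` W by exact: interior_subset.
have eU' : open_nbhs e U' by split; [exact: open_interior|exact: filterI].
have [x' [m' [Ux' m'0 xm']]] := stage_elt (open_nbhs_nbhs eU').
exists (Stage x' m' M' U'); first split=> //=.
  by move=> b _ [y /U'VW[_ Wy] <-]; apply: (WU b); exists y.
split; split => //= h Mh.
by apply: smallS (VM h Mh); apply: image_subset => y /U'VW[].
Qed.

(** The tails [y eps j] are limits of partial products along one fixed ultrafilter. Continuity of
    [branch] and uniqueness of limits carry the recursion over to them. *)
Lemma branching_group : card_le [set: nat -> bool] [set: A].
Proof.
have [mulA [mul1 [mulr1 _]]] := grp.
have [S [S0 SN Sgood]] : exists S : nat -> stage, [/\ st_M (S 0%N) id, (forall n, next_stage (S n) (S n.+1)) &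
    forall n, good_stage n (S n) /\ good_elt (S n)].
  have [U eU Us] := small_nbhs 0 e.
  have [x [m [Ux m0 xm]]] := stage_elt (nbhs_interior eU).
  pose P (ns : nat * stage) := good_stage ns.1 ns.2 /\ good_elt ns.2.
  have s0 : P (0%N, Stage x m [set id] (interior U)).
    split; split => //=.
    - split; [exact: open_interior|exact: eU].
    - by move=> B BM; exists (B id) => [|_ -> //]; exact: BM.
    - by move=> _ -> z; exact: cvg_id.
    - by move=> _ ->; rewrite image_id; apply: smallS Us; exact: interior_subset.
  have step (u : {ns | P ns}) : {v : {ns | P ns} |
      (sval v).1 = (sval u).1.+1 /\ next_stage (sval u).2 (sval v).2}.
    apply: cid; case: u => [[n s] [sg se]] /=.
    have [s' ss' s'g] := next_stageP sg se.
    by exists (exist P (n.+1, s') s'g).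
  have [F [F0 FS]] := dependent_choice step (exist P _ s0).
  have Fn n : (sval (F n)).1 = n.
    by elim: n => [|n IH]; [rewrite F0|rewrite (FS n).1 IH].
  exists (fun n => (sval (F n)).2); split => [|n|n]; first by rewrite F0.
    by have [] := FS n.
  by have := svalP (F n); rewrite /P Fn.
pose T n := branch (st_x (S n)) (st_m (S n)).
pose fix comp (eps : nat -> bool) (j k : nat) {struct k} : G -> G :=
  if k is k'.+1 then T j (eps j) \o comp eps j.+1 k' else id.
have compD eps j k k' : comp eps j (k + k')%N = comp eps j k \o comp eps (j + k)%N k'.
  elim: k j => [j|k IH j]; first by rewrite addn0.
  by rewrite addSn -[LHS]/(T j (eps j) \o comp eps j.+1 (k + k')%N) IH addSnnS compA.
have compSr eps j k : comp eps j k.+1 = comp eps j k \o T (j + k)%N (eps (j + k)%N).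
  by rewrite -addn1 compD.
have compM eps j k : st_M (S (j + k)%N) (comp eps j k).
  elim: k => [|k IH].
    by case: j => [|j]; rewrite addn0 ?(SN j).2//; left.
  by rewrite addnS (SN _).2 compSr; right; exists (comp eps j k) => //; eexists.
have U_e n : st_U (S n) e by have [[[_ ?] _ _ _] _] := Sgood n.
have TU n b y : st_U (S n.+1) y -> st_U (S n) (T n b y).
  by move=> Uy; apply: ((SN n).1 b); exists y.
have compU eps j k y : st_U (S (j + k)%N) y -> st_U (S j) (comp eps j k y).
  elim: k j => [|k IH] j; first by rewrite addn0.
  by rewrite -addSnnS => Uy; apply: TU; exact: IH.
have [F [FU ooF]] := ultraFilterLemma eventually_filter.
pose u eps j n := comp eps j (n - j)%N e.
(* From index [N] on, the partial products lie in the image of the [N]-th neighbourhood under a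
   composite of stage [N]. That image is small of order [N], hence of order [n]. *)
have u_small eps j n : exists2 X, (u eps j @ F) X & small n X.
  pose N := maxn j n; have jN : (j + (N - j) = N)%N by rewrite subnKC// leq_maxl.
  have [[_ _ _ /(_ _ (compM eps j (N - j)%N)) smallN] _] := Sgood (j + (N - j))%N.
  exists (comp eps j (N - j)%N @` st_U (S (j + (N - j))%N)).
    apply: ooF; exists N => // k /= Nk; rewrite /u.
    have -> : (k - j = (N - j) + (k - N))%N.
      by move: Nk jN; clearbody N; lia.
    rewrite compD; exists (comp eps (j + (N - j))%N (k - N)%N e) => //.
    by apply: compU.
  by apply: small_le smallN; rewrite jN leq_maxr.
have y_ex eps j : exists y : G, u eps j @ F --> y.
  by apply: small_cvg (u_small eps j); exact: fmap_ultra.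
have [y0 y0P] := choice (fun p : (nat -> bool) * nat => y_ex p.1 p.2).
pose y eps j := y0 (eps, j).
have yE eps j : y eps j = T j (eps j) (y eps j.+1).
  apply: (cvg_unique hG (F := u eps j @ F)); first exact: (y0P (eps, j)).
  have Tu : T j (eps j) \o u eps j.+1 @ F --> T j (eps j) (y eps j.+1).
    apply: cvg_comp; first exact: (y0P (eps, j.+1)).
    exact: branch_continuous.
  (* Above index [j], the sequence [u eps j] is the image of [u eps j.+1] under [T j (eps j)]. *)
  apply: cvg_trans Tu; apply: near_eq_cvg; apply: ooF.
  by exists j.+1 => // n /= jn; rewrite /u -(subnSK jn).
apply: contrapT => cA.
apply: (no_branching tfA cA (a := fun n => f (st_x (S n))) (m := fun n => st_m (S n))
  (F := fun eps n => f (y eps n))).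
- by move=> n; have [_ []] := Sgood n.
- by move=> n; have [_ []] := Sgood n.
- by move=> eps n; rewrite [in LHS]yE gmorph_branch.
Qed.

End BranchingGroup.

Lemma invS_lt (r : RR) : 0 < r -> exists n : nat, n.+1%:R^-1 < r.
Proof. by move=> /ltr_add_invr[n]; rewrite add0r; exists n. Qed.

Lemma kernel_open_of_small (A : zmodType) (G : topologicalType) mul inv (e : G)
    (f : G -> A) (small : nat -> set G -> Prop) :
  torsion_free_reduced A -> ~ card_le [set: nat -> bool] [set: A] ->
  is_topgroup mul inv e -> (forall x y, f (mul x y) = f x + f y) ->
  hausdorff_space G ->
  (forall n (x : G), exists2 U, nbhs x U & small n U) ->
  (forall n S S', S' `<=` S -> small n S -> small n S') ->
  (forall n n' S, (n <= n')%N -> small n' S -> small n S) ->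
  (forall F : set_system G, UltraFilter F ->
    (forall n, exists2 S, F S & small n S) -> exists x : G, F --> x) ->
  open [set x | f x = 0].
Proof.
move=> tA cA grp fM hG s1 s2 s3 s4; apply: (kernel_openP grp fM).
by apply: contrapT => nf; apply: cA; apply: (branching_group grp fM hG s1 s2 s3 s4 tA nf).
Qed.

Lemma tfr_lcHslender (A : zmodType) : torsion_free_reduced A ->
  ~ card_le [set: nat -> bool] [set: A] -> lcHslender A.
Proof.
move=> tA cA G mul inv e grp [hG lcG] f fM.
apply: (kernel_open_of_small (small := fun _ S => exists2 K, compact K & S `<=` K) tA cA grp fM hG).
- by move=> _ x; have [K [cK xK]] := lcG x; exists K => //; exists K.
- by move=> _ S S' SS' [K cK SK]; exists K => //; exact: subset_trans SK.
- by [].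
- move=> F FU /(_ 0%N)[S FS [K cK SK]].
  move: cK; rewrite compact_ultra => /(_ F FU (filterS SK FS))[x [_ Fx]].
  by exists x.
Qed.

Lemma tfr_cmslender (A : zmodType) : torsion_free_reduced A ->
  ~ card_le [set: nat -> bool] [set: A] -> cmslender A.
Proof.
move=> tA cA G mul inv e grp [d [d0 [dE [dC [dT [dO dcomplete]]]]]] f fM.
have dxx x : d x x = 0 by apply/dE.
have nbhs_ball (x : G) (r : RR) : 0 < r -> nbhs x [set y | d x y < r].
  move=> r0; apply: open_nbhs_nbhs; split; last by rewrite /= dxx.
  apply/dO => y /= xy; exists (r - d x y); first by rewrite subr_gt0.
  by move=> z /=; rewrite ltrBrDl; exact: le_lt_trans.
have hG : hausdorff_space G.
  move=> x y xy; apply/dE; have [//|dxy] := eqVneq (d x y) 0.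
  have dxy0 : 0 < d x y / 2 by rewrite divr_gt0// lt_neqAle eq_sym dxy d0.
  have [z [/= xz yz]] := xy _ _ (nbhs_ball x _ dxy0) (nbhs_ball y _ dxy0).
  by have := dT x z y; rewrite (dC z y) leNgt [X in _ < X]splitr ltrD.
apply: (kernel_open_of_small
  (small := fun n S => forall x y, S x -> S y -> d x y < n.+1%:R^-1) tA cA grp fM hG).
- move=> n x; have n0 : (0 : RR) < n.+1%:R^-1 / 2 by rewrite divr_gt0.
  exists [set y | d x y < n.+1%:R^-1 / 2]; first exact: nbhs_ball.
  move=> y z /= xy xz; apply: le_lt_trans (dT y x z) _.
  by rewrite (dC y x) [X in _ < X]splitr ltrD.
- by move=> n S S' SS' Sn x y /SS' Sx /SS' Sy; exact: Sn.
- move=> n n' S nn' Sn x y Sx Sy; apply: lt_le_trans (Sn _ _ Sx Sy) _.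
  by rewrite lef_pV2 ?posrE ?ltr0n// ler_nat ltnS.
- move=> F FU small_F.
  have SP n : exists S : set G, F S /\
      forall x y, S x -> S y -> d x y < n.+1%:R^-1.
    by have [S] := small_F n; exists S.
  have {SP}[S SP] := choice SP.
  (* Points chosen in the intersections of the first [n+1] sets of shrinking diameter form a Cauchy
     sequence. *)
  have SI n : F [set x | forall k, (k < n.+1)%N -> S k x].
    elim: n => [|n IH]; first by apply: filterS (SP 0%N).1 => x Sx [].
    apply: filterS (filterI IH (SP n.+1).1) => x [Sx Snx] k.
    by rewrite ltnS leq_eqVlt => /predU1P[->//|]; exact: Sx.
  have [u uP] := choice (fun n => filter_ex (SI n)).
  have [eps eps0|l ul] := dcomplete u.
    have [N Neps] := invS_lt eps0; exists N => m n Nm Nn.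
    apply: lt_trans Neps; apply: (SP N).2; apply: uP; rewrite ltnS//.
  exists l => U; rewrite /= nbhsE => -[V [oV Vl] VU].
  have [r r0 rV] := (dO V).1 oV l Vl.
  have r20 : 0 < r / 2 by rewrite divr_gt0.
  have [n nr] := invS_lt r20; have [N NP] := ul _ r20.
  (* [y] and [u (maxn n N)] both lie in [S n], and the latter is within [r / 2] of the limit. *)
  apply: filterS (SP n).1 => y Sy; apply/VU/rV => /=.
  have uM : d l (u (maxn n N)) < r / 2 by rewrite dC; apply: NP; exact: leq_maxr.
  apply: le_lt_trans (dT _ (u (maxn n N)) _) _; rewrite [X in _ < X]splitr ltrD//.
  apply: lt_trans nr; apply: (SP n).2 => //; apply: uP.
  by rewrite ltnS leq_maxl.
Qed.

(** * Discontinuous homomorphisms *)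

Definition discontinuous_hom (A : zmodType) (G : topologicalType) := 
  exists mul inv (e : G), [/\ is_topgroup mul inv e, completely_metrizable G,
   locally_compact_hausdorff G &
   exists2 f : G -> A, (forall x y, f (mul x y) = f x + f y) &
   ~ open [set x | f x = 0]].

(** The map sending [n] to [a *~ n] extends from the integers to the reals. An open kernel would
    contain some [1/(n+1)], hence 1, whose value is [a]. *)
Lemma divisible_discontinuous_hom (A : zmodType) (a : A) :
  (forall (a : A) n, (0 < n)%N -> a *+ n = 0 -> a = 0) -> a <> 0 -> divisible_elt a ->
  discontinuous_hom A RR.
Proof.
move=> tfA a0 Da.
pose G0 := [set u | exists n, u = (n%:~R, a *~ n)] : set (RR * A).
have pG0 : partial_hom (@divisible_elt A) G0.
  split.
  - by exists 0; rewrite !mulr0z.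
  - by move=> _ _ [n ->] [n' ->]; exists (n - n'); rewrite !mulrzBr.
  - by move=> b [n [/esym/eqP]]; rewrite intr_eq0 => /eqP -> ->; rewrite mulr0z.
  - move=> _ [n ->] /= m m0; have [b ->] := Da m m0.
    by exists (b *~ n); rewrite !pmulrn -!mulrzA mulrC.
have [f fD fE] := divisible_extend tfA pG0.
exists +%R, -%R, 0; split.
- split; first exact: addrA.
  split; first exact: add0r.
  split; first exact: addr0.
  split; first exact: addNr.
  split; first exact: subrr.
  split=> x; last by apply: (@cvgN RR RR^o _ _ _ id); exact: cvg_id.
  by apply: (@cvgD RR RR^o _ _ _ fst snd); [exact: cvg_fst|exact: cvg_snd].
- exists (fun x y => `|x - y|).
  split; first by move=> x y; exact: normr_ge0.
  split; first by move=> x y; split=> [/normr0_eq0/subr0_eq //|->]; rewrite subrr normr0.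
  split; first by move=> x y; exact: distrC.
  split; first by move=> x y z; exact: ler_distD.
  split.
    move=> U; rewrite openE; split=> UP x Ux.
      by have /nbhs_ballP[r r0 rU] := UP _ Ux; exists r.
    by have [r r0 rU] := UP _ Ux; apply/nbhs_ballP; exists r.
  move=> u ucauchy; have /cvg_ex[l ul] : cvg (u @ \oo).
    apply: R_complete; apply/cauchyP => r r0.
    have [N NP] := ucauchy r r0; exists (u N); exists N => // n Nn.
    exact: NP.
  exists l => r r0; have /(@cvgrPdistC_lt RR RR^o)/(_ r r0)[N _ NP] := ul.
  by exists N => n Nn; exact: NP.
- split; first exact: Rhausdorff.
  move=> x; exists [set` `[x - 1, x + 1]]; split; first exact: segment_compact.
  apply/nbhs_ballP; exists 1 => //= y; rewrite /ball/= ltr_distlC => /andP[xy yx].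
  by rewrite in_itv/= !ltW.
exists f => // oK.
have f1 n : f n%:~R = a *~ n by apply: (fE (n%:~R, a *~ n)); exists n.
have : nbhs (0 : RR) [set x | f x = 0].
  by apply: open_nbhs_nbhs; split => //=; rewrite (hom0 fD).
move=> /nbhs_ballP[r r0 rK]; have [n nr] := invS_lt r0.
apply: a0; rewrite -[a]mulr1z -f1.
have -> : (1%:~R : RR) = n.+1%:R^-1 *+ n.+1 by rewrite -[RHS]mulr_natr mulVf.
rewrite (homMn fD) (rK n.+1%:R^-1) ?mul0rn//.
by rewrite /ball/= sub0r normrN ger0_norm.
Qed.

(** * Countable powers of a finite cyclic group *)

Section DiscretePower.
Variable p : nat.

Definition Zp_seq := prod_topology (fun _ : nat => discrete_topology 'Z_p).

Definition agree (n : nat) (x y : Zp_seq) := forall i, (i < n)%N -> x i = y i.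

(** For the direct implication, the filter generated by the agreement sets converges to [x] in each
    coordinate, hence in the product, and so contains every neighbourhood of [x]. *)
Lemma nbhs_Zp_seq (x : Zp_seq) (U : set Zp_seq) :
  nbhs x U <-> exists n, forall y, agree n x y -> U y.
Proof.
split; last first.
  move=> [n nU]; have : nbhs x [set y | agree n x y].
    elim: n {nU} => [|n IH]; first by apply: filterS filterT => y _ i.
    have xn : nbhs x [set y : Zp_seq | y n = x n].
      apply: (@proj_continuous _ (fun _ : nat => discrete_topology 'Z_p) n x [set x n]).
      exact: discrete_set1.
    apply: filterS (filterI IH xn) => y [xy ynxn] i.
    by rewrite ltnS leq_eqVlt => /predU1P[->//|]; exact: xy.
  by apply: filterS => y; exact: nU.
pose F := filter_from [set: nat] (fun n => [set y | agree n x y]).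
have FF : ProperFilter F.
  apply: filter_from_proper.
    apply: filter_fromT_filter; first by exists 0%N.
    move=> i j; exists (maxn i j) => y xy; split => k ki; apply: xy.
      by rewrite (leq_trans ki)// leq_maxl.
    by rewrite (leq_trans ki)// leq_maxr.
  by move=> i _; exists x.
have Fx : F --> x.
  apply/cvg_sup => i; apply/cvg_image.
    by rewrite -subTset => z _; exists (fun=> z).
  move=> V /= iV; exists [set y : Zp_seq | V (y i)].
    exists i.+1 => // y xy /=; rewrite -(xy i)//.
    exact: (nbhs_singleton iV).
  apply/seteqP; split => [_ [y Vy <-] //|z Vz].
  by exists (fun=> z).
by move=> /Fx[n _ nU]; exists n.
Qed.

Lemma open_Zp_seq (U : set Zp_seq) :
  open U <-> forall x, U x -> exists n, forall y, agree n x y -> U y.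
Proof.
rewrite openE; split=> UP x Ux; first by have /nbhs_Zp_seq := UP _ Ux.
by apply/nbhs_Zp_seq; exact: UP.
Qed.

(** This is [1/(i+1)] for the first index [i] of disagreement; the element 0 keeps the set nonempty
    for equal sequences. *)
Definition Zp_dist (x y : Zp_seq) : RR :=
  sup [set r : RR | r = 0 \/ exists2 i : nat, x i <> y i & r = i.+1%:R^-1].

Lemma Zp_dist_le (x y : Zp_seq) n : (Zp_dist x y <= n.+1%:R^-1) <-> agree n x y.
Proof.
rewrite /Zp_dist; set D := [set r | _].
have D0 : D !=set0 by exists 0; left.
have uD : has_ubound D.
  exists 1 => r [->//|[i _ ->]]; rewrite invf_le1 ?ler1n//.
split=> [le_n i ni|xy].
  apply: contrapT => xyi; have : i.+1%:R^-1 <= sup D.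
    by apply: ub_le_sup => //; right; exists i.
  move=> /le_trans/(_ le_n); rewrite lef_pV2 ?posrE// ler_nat.
  by rewrite ltnNge ni.
apply: ge_sup => // r [->|[i xyi ->]]; first by rewrite invr_ge0.
rewrite lef_pV2 ?posrE// ler_nat ltnS leqNgt; apply/negP => /xy.
exact: xyi.
Qed.

Lemma Zp_dist_lt (x y : Zp_seq) n : (Zp_dist x y < n.+1%:R^-1) -> agree n x y.
Proof. by move=> /ltW/Zp_dist_le. Qed.

Lemma agree_Zp_dist (x y : Zp_seq) n : agree n.+1 x y -> (Zp_dist x y < n.+1%:R^-1).
Proof.
move=> /Zp_dist_le/le_lt_trans; apply.
by rewrite ltf_pV2 ?posrE// ltr_nat.
Qed.

Lemma Zp_dist_ge0 x y : 0 <= Zp_dist x y.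
Proof.
apply: ub_le_sup; last by left.
by exists 1 => r [->//|[i _ ->]]; rewrite invf_le1 ?ler1n.
Qed.

Lemma Zp_dist_tri x y z : Zp_dist x z <= Zp_dist x y + Zp_dist y z.
Proof.
apply: ge_sup; first by exists 0; left.
move=> r [->|[i xzi ->]]; first by rewrite addr_ge0// Zp_dist_ge0.
have ge u v : u i <> v i -> i.+1%:R^-1 <= Zp_dist u v.
  move=> uvi; apply: ub_le_sup; last by right; exists i.
  by exists 1 => r' [->//|[j _ ->]]; rewrite invf_le1 ?ler1n.
(* An index where [x] and [z] differ separates [y] from one of them. *)
have [xyi|xyi] := pselect (x i = y i).
  by rewrite ler_wpDl ?Zp_dist_ge0// ge//= -xyi.
by rewrite ler_wpDr ?Zp_dist_ge0// ge.
Qed.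

Lemma Zp_seq_complete : completely_metrizable Zp_seq.
Proof.
exists Zp_dist; split; first exact: Zp_dist_ge0.
have d0 x y : Zp_dist x y = 0 <-> x = y.
  split=> [xy|->].
    by apply/funext => i; apply: (@Zp_dist_lt x y i.+1) => //; rewrite xy.
  apply/eqP; rewrite eq_le Zp_dist_ge0 andbT leNgt; apply/negP => /invS_lt[n].
  rewrite ltNge; apply/negP; rewrite negbK.
  by apply/Zp_dist_le.
split=> //; split.
  move=> x y; rewrite /Zp_dist; congr sup; apply/seteqP.
  by split=> r [->|[i xyi ->]]; [left|right; exists i => // /esym|left|right; exists i => // /esym].
split; first exact: Zp_dist_tri.
split.
  move=> U; split=> [/open_Zp_seq UP x Ux|UP].
    have [n nU] := UP x Ux; exists n.+1%:R^-1 => // y /= /Zp_dist_lt; exact: nU.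
  apply/open_Zp_seq => x Ux; have [r r0 rU] := UP x Ux.
  have [n nr] := invS_lt r0; exists n.+1 => y xy; apply: rU => /=.
  by apply: lt_trans nr; exact: agree_Zp_dist.
move=> u uC.
have NP k : exists N, forall n, (N <= n)%N -> agree k (u N) (u n).
  have [|N NP] := uC k.+1%:R^-1 => //; exists N => n Nn.
  by apply: Zp_dist_lt; exact: NP.
have {NP}[N NP] := choice NP.
(* From index [N i.+1] on, coordinate [i] no longer changes. *)
exists (fun i => u (N i.+1) i) => r /invS_lt[n nr].
exists (\max_(k < n.+2) N k)%N => m Nm; apply: lt_trans nr; apply: agree_Zp_dist => i ni.
rewrite (NP i.+1 m)//; apply: leq_trans Nm.
exact: (@leq_bigmax_cond _ xpredT (fun k : 'I_n.+2 => N k) (Ordinal (ni : i.+1 < n.+2)%N)).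
Qed.

Lemma Zp_seq_lch : locally_compact_hausdorff Zp_seq.
Proof.
split.
  apply: (@hausdorff_product _ (fun _ : nat => discrete_topology 'Z_p)) => _.
  exact: discrete_hausdorff.
move=> x; exists setT; split; last exact: filterT.
have := @tychonoff _ (fun _ : nat => discrete_topology 'Z_p) (fun=> setT).
rewrite (_ : [set f | _] = setT); last by apply/seteqP; split.
by apply => _; apply: finite_compact; exact: (@finite_finset 'Z_p).
Qed.

Definition Zp_add (x y : Zp_seq) : Zp_seq := fun i => ((x i : 'Z_p) + (y i : 'Z_p)).
Definition Zp_neg (x : Zp_seq) : Zp_seq := fun i => - (x i : 'Z_p).

Lemma Zp_seq_group : is_topgroup Zp_add Zp_neg (fun=> 0 : 'Z_p).
Proof.
split; first by move=> x y z; apply/funext => i; exact: addrA.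
split; first by move=> x; apply/funext => i; exact: add0r.
split; first by move=> x; apply/funext => i; exact: addr0.
split; first by move=> x; apply/funext => i; exact: addNr.
split; first by move=> x; apply/funext => i; exact: subrr.
split.
  move=> [x y] U /nbhs_Zp_seq[n nU].
  exists ([set x' | agree n x x'], [set y' | agree n y y']).
    by split; apply/nbhs_Zp_seq; exists n.
  move=> [x' y'] [/= xx yy]; apply: nU => i ni; rewrite /Zp_add/=.
  by rewrite (xx i ni) (yy i ni).
move=> x U /nbhs_Zp_seq[n nU]; apply/nbhs_Zp_seq; exists n => y xy.
by apply: nU => i ni; rewrite /Zp_neg (xy i ni).
Qed.

End DiscretePower.

(** Lifting residues to integer representatives is additive up to carries times [p], and [f0] kills
    multiples of [p]. *)
Lemma torsion_discontinuous_hom (A : zmodType) p (a : A) : prime p -> a <> 0 -> a *+ p = 0 ->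
  discontinuous_hom A (Zp_seq p).
Proof.
move=> pp a0 ap; have [f0 f0D [f0e f0p]] := torsion_seq_hom pp ap.
pose lift (x : Zp_seq p) : nat -> int := fun i => (x i : 'Z_p)%:Z.
pose f x := f0 (lift x).
exists (@Zp_add p), (@Zp_neg p), (fun=> 0 : 'Z_p); split.
- exact: Zp_seq_group.
- exact: Zp_seq_complete.
- exact: Zp_seq_lch.
exists f => [x y|].
  pose q : nat -> int := fun i => (((x i : 'Z_p) + (y i : 'Z_p))%N %/ p)%:Z.
  have divE s : s = (s %% (Zp_trunc p).+2 + s %/ p * p)%N.
    by rewrite Zp_cast ?prime_gt1// addnC -divn_eq.
  have liftD : lift x + lift y = lift (Zp_add x y) + q *+ p.
    apply/funext => i; rewrite -[LHS]/(lift x i + lift y i).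
    rewrite -[RHS]/(lift (Zp_add x y) i + (q *+ p) i) natmulfctE /lift /q /Zp_add /=.
    by rewrite -mulr_natr natz -PoszM -!PoszD; congr Posz; exact: divE.
  by rewrite /f -f0D liftD f0D f0p addr0.
move/open_Zp_seq => /(_ (fun=> 0 : 'Z_p)) [|n nK].
  by rewrite /= -(hom0 f0D); congr f0; apply/funext.
apply: a0; rewrite -(f0e n).
(* The lifted sequence agrees with 0 in the first [n] coordinates, yet its value is [a]. *)
have -> : eseq n = lift (fun i => if i == n then 1 else 0 : 'Z_p).
  by apply/funext => i; rewrite /eseq /lift; case: eqP.
by apply: nK => i ni; rewrite ltn_eqF.
Qed.

Lemma not_tfr_discontinuous_hom (A : zmodType) : ~ torsion_free_reduced A ->
  exists G : topologicalType, discontinuous_hom A G.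
Proof.
move=> /not_torsion_free_reduced[[p [a [pp a0 ap]]]|[tfA [a a0 Da]]].
  by exists (Zp_seq p); exact: (@torsion_discontinuous_hom _ p a).
by exists RR; exact: (@divisible_discontinuous_hom _ a).
Qed.

Lemma cmslender_tfr (A : zmodType) : cmslender A -> torsion_free_reduced A.
Proof.
move=> cA; apply: contrapT => /not_tfr_discontinuous_hom[G [mul [inv [e [grp cG _ [f fM nf]]]]]].
by apply: nf; exact: cA grp cG f fM.
Qed.

Lemma lcHslender_tfr (A : zmodType) : lcHslender A -> torsion_free_reduced A.
Proof.
move=> cA; apply: contrapT => /not_tfr_discontinuous_hom[G [mul [inv [e [grp _ lG [f fM nf]]]]]].
by apply: nf; exact: cA grp lG f fM.
Qed.

(** * The earring and winding numbers *)

(* At points of the earring other than the origin, [kappa] is the index of the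
   circle; [kappa 0 = 0] by the convention [0^-1 = 0]. *)
Definition kappa (R : realType) (p : R * R) : R := 2 * p.2 / (p.1 ^+ 2 + p.2 ^+ 2).

Lemma kappa_cvg (R : realType) (p : R * R) : p.2 != 0 -> kappa q @[q --> p] --> kappa p.
Proof.
move=> p0; have p10 : p.1 ^+ 2 + p.2 ^+ 2 != 0.
  by rewrite paddr_eq0 ?sqr_ge0// !expf_eq0/= negb_and p0 orbT.
apply: cvgM; first by apply: cvgMr; exact: cvg_snd.
apply: cvgV => //; apply: cvgD; apply: cvgM.
all: by [exact: cvg_fst|exact: cvg_snd].
Qed.

Lemma near_kappa (R : realType) (p : R * R) : p.2 != 0 ->
  \forall q \near p, q.2 != 0 /\ `|kappa q - kappa p| < 1.
Proof.
move=> p0; apply: filterI.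
  have C : snd q @[q --> p] --> p.2 by exact: cvg_snd.
  exact: (cvgr_neq0 _ C p0).
by have /cvgrPdistC_lt := kappa_cvg p0; exact.
Qed.

Lemma near_fst_lt (R : realType) (p : R * R) (c : R) : p.1 < c -> \forall q \near p, q.1 < c.
Proof. by move=> pc; have C : fst q @[q --> p] --> p.1 by [exact: cvg_fst]; exact: (cvgr_lt _ C _ pc). Qed.

Lemma near_fst_gt (R : realType) (p : R * R) (c : R) : c < p.1 -> \forall q \near p, c < q.1.
Proof. by move=> pc; have C : fst q @[q --> p] --> p.1 by [exact: cvg_fst]; exact: (cvgr_gt _ C _ pc). Qed.

Lemma near_snd_lt (R : realType) (p : R * R) (c : R) : p.2 < c -> \forall q \near p, q.2 < c.
Proof. by move=> pc; have C : snd q @[q --> p] --> p.2 by [exact: cvg_snd]; exact: (cvgr_lt _ C _ pc). Qed.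

Lemma near_snd_gt (R : realType) (p : R * R) (c : R) : c < p.2 -> \forall q \near p, c < q.2.
Proof. by move=> pc; have C : snd q @[q --> p] --> p.2 by [exact: cvg_snd]; exact: (cvgr_gt _ C _ pc). Qed.

Lemma circleE n (p : RR * RR) : (0 < n)%N ->
  circle n p <-> n%:R * (p.1 ^+ 2 + p.2 ^+ 2) = 2 * p.2.
Proof.
move=> n0; have n0' : (n%:R : RR) != 0 by rewrite pnatr_eq0 -lt0n.
rewrite /circle/=; split=> E.
  have -> : p.1 ^+ 2 + p.2 ^+ 2 = p.1 ^+ 2 + (p.2 - n%:R^-1) ^+ 2 - n%:R^-1 ^+ 2 + 2 * n%:R^-1 * p.2 by ring.
  by rewrite E; field.
have -> : p.1 ^+ 2 + (p.2 - n%:R^-1) ^+ 2 =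
  n%:R^-1 * (n%:R * (p.1 ^+ 2 + p.2 ^+ 2)) - 2 * n%:R^-1 * p.2 + n%:R^-1 ^+ 2 by field.
by rewrite E; ring.
Qed.

Lemma sqr_sum_gt0 (p : RR * RR) : p.2 != 0 -> 0 < p.1 ^+ 2 + p.2 ^+ 2.
Proof. by move=> p0; rewrite ltr_wpDl ?sqr_ge0// exprn_even_gt0. Qed.

Lemma circle_kappa n (p : RR * RR) : (0 < n)%N -> p.2 != 0 ->
  circle n p <-> kappa p = n%:R.
Proof.
move=> n0 p0; have s0 : p.1 ^+ 2 + p.2 ^+ 2 != 0 by rewrite gt_eqF// sqr_sum_gt0.
rewrite circleE// /kappa; split=> [<-|<-]; first by rewrite mulfK.
by rewrite divfK.
Qed.

Lemma circle_snd0 n p : (0 < n)%N -> circle n p -> p.2 = 0 -> p = origin.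
Proof.
move=> n0 /(circleE _ n0) + p2; rewrite p2 mulr0 => /eqP.
rewrite mulf_eq0 pnatr_eq0 -[n == 0%N]negbK -lt0n n0 /= expr0n/= addr0 sqrf_eq0 => /eqP p1.
by rewrite [p]surjective_pairing p1 p2.
Qed.

Lemma earring_snd0 p : earring p -> p.2 = 0 -> p = origin.
Proof. by move=> [n [n0 /circle_snd0]]; exact. Qed.

Lemma earring_kappa p : earring p -> p.2 != 0 -> exists2 n, (0 < n)%N & kappa p = n%:R.
Proof. by move=> [n [n0 pn]] p0; exists n => //; apply/circle_kappa. Qed.

Lemma earring_origin : earring origin.
Proof. by exists 1%N; split=> //; apply/circleE; rewrite //= expr0n/= addr0 !mulr0. Qed.

Lemma earring_ge0 p : earring p -> 0 <= p.2.
Proof.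
move=> [n [n0 /(circleE _ n0) pn]].
by rewrite -(@pmulr_rge0 _ 2)// -pn mulr_ge0// addr_ge0// sqr_ge0.
Qed.

(** Off the horizontal axis [kappa] is continuous, and on the earring it takes integer values there;
    hence it is locally constant. *)
Lemma near_earring_kappa p : earring p -> p.2 != 0 ->
  \forall q \near p, earring q -> q.2 != 0 /\ kappa q = kappa p.
Proof.
move=> Ep p0; apply: filterS (near_kappa p0) => q [q0 qp] Eq; split=> //.
have [n _ pn] := earring_kappa Ep p0; have [m _ qm] := earring_kappa Eq q0.
move: qp; rewrite pn qm => mn; congr _%:R; apply/eqP; move: mn.
have -> : (m%:R - n%:R : RR) = (m%:Z - n%:Z)%:~R by rewrite rmorphB.
rewrite -intr_norm (_ : 1 = 1%:~R)// ltr_int; lia.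
Qed.

(** The inequality selects the open upper half of the [k]-th circle, whose centre has height
    [1/k]. *)
Definition top (k : nat) (p : RR * RR) : bool := (kappa p == k%:R) && (1 < k%:R * p.2).

Definition east (p : RR * RR) : int := if 0 <= p.1 then 1 else 0.

(* Signed crossing number of the upper half of the axis of the [k]-th circle by
   a short step from [p] to [q]. *)
Definition crossing (k : nat) (p q : RR * RR) : int :=
  if top k p && top k q then east q - east p else 0.

(* On [U] the cocycle [d] is the coboundary of an integer-valued function. *)
Definition locally_exact (d : RR * RR -> RR * RR -> int) (U : set (RR * RR)) : Prop :=
  exists s : RR * RR -> int, forall q q', U q -> U q' -> earring q -> earring q' ->
    d q q' = s q' - s q.

(** Off the vertical axis [east] is locally constant. On the axis, the origin and the points of
    other circles have neighbourhoods without [top k] points, while near the highest point of the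
    [k]-th circle all points are [top k] and [east] itself is a primitive. *)
Lemma crossing_locally_exact k p : (0 < k)%N -> earring p ->
  exists2 U, nbhs p U & locally_exact (crossing k) U.
Proof.
move=> k0 Ep.
have notop U : (forall q, U q -> earring q -> ~~ top k q) -> locally_exact (crossing k) U.
  move=> Utop; exists (fun=> 0) => q q' Uq _ Eq _.
  by rewrite /crossing (negPf (Utop q Uq Eq)) subrr.
have [p1|p1|p1] := ltrgtP 0 p.1.
- exists [set q | 0 < q.1]; first exact: near_fst_gt.
  exists (fun=> 0) => q q' /= q0 q'0 _ _.
  by rewrite /crossing /east !ltW// subrr; case: ifP.
- exists [set q | q.1 < 0]; first exact: near_fst_lt.
  exists (fun=> 0) => q q' /= q0 q'0 _ _.
  by rewrite /crossing /east !leNgt q0 q'0 subrr; case: ifP.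
have [p2|p2] := eqVneq p.2 0.
  exists [set q | q.2 < k%:R^-1].
    by apply: near_snd_lt; rewrite p2 invr_gt0 ltr0n.
  apply: notop => q /= qk _; rewrite /top negb_and -leNgt.
  by rewrite mulrC -ler_pdivlMr ?ltr0n// div1r (ltW qk) orbT.
have [n n0 pn] := earring_kappa Ep p2.
have [kn|kn] := eqVneq k n; last first.
  exists [set q | earring q -> q.2 != 0 /\ kappa q = kappa p]; first exact: near_earring_kappa.
  apply: notop => q /= /[apply] -[_ qp]; rewrite /top qp pn eqr_nat eq_sym.
  by rewrite (negPf kn).
exists ([set q | earring q -> q.2 != 0 /\ kappa q = kappa p] `&` [set q | k%:R^-1 < q.2]).
  apply: filterI; first exact: near_earring_kappa.
  apply: near_snd_gt; have /(circle_kappa n0 p2)/(circleE _ n0) := pn.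
  rewrite -p1 expr0n/= add0r expr2 mulrA => /(mulIf p2) np2.
  by rewrite -[_^-1]mul1r ltr_pdivrMr ?ltr0n// mulrC kn np2 ltr1n.
have topq q : earring q -> (earring q -> q.2 != 0 /\ kappa q = kappa p) -> k%:R^-1 < q.2 -> top k q.
  move=> Eq /(_ Eq)[_ qp] qk; rewrite /top qp pn kn eqxx /= mulrC -ltr_pdivrMr ?ltr0n//.
  by rewrite div1r -kn.
exists east => q q' [/= q1 q2] [/= q'1 q'2] Eq Eq'.
by rewrite /crossing !topq.
Qed.

(** [C] may be any property inherited by subsets, such as lying in a member of a cover. The
    near-covering form of compactness turns local radii into a common one. *)
Lemma lebesgue_number (M : pseudoMetricType RR) (K : set M) (C : set M -> Prop) :
  compact K -> (forall U V, U `<=` V -> C V -> C U) ->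
  (forall x, K x -> exists2 U, nbhs x U & C U) ->
  exists2 r : RR, 0 < r & forall x, K x -> C (ball x r).
Proof.
move=> /compact_near_coveringP cK CS CK.
have : \forall r \near (0 : RR)^'+, K `<=` (fun x => C (ball x r)).
  apply: cK => x /CK[U /nbhs_ballP[r /= r0 rU] CU].
  have r20 : 0 < r / 2 by rewrite divr_gt0.
  exists (ball x (r / 2), [set s | s < r / 2]).
    split; first exact: nbhsx_ballx.
    exact: nbhs_right_lt.
  move=> [y s] [/= xy sr]; apply: CS CU => z yz; apply: rU.
  rewrite [r]splitr; apply: ball_triangle xy _.
  by apply: le_ball yz; exact: ltW.
move=> /(filterI (nbhs_right_gt (0:RR))) /filter_ex[r [/= r0 rK]].
by exists r.
Qed.

Section Winding.
Variable d : RR * RR -> RR * RR -> int.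
Hypothesis dloc : forall p, earring p -> exists2 U, nbhs p U & locally_exact d U.

Definition steps (n : nat) (g : RR -> RR * RR) : int :=
  \sum_(0 <= i < n) d (g (i%:R / n%:R)) (g (i.+1%:R / n%:R)).

(** With radius [2 / n] the open ball around a point of the grid of mesh [1 / n] contains the
    neighbouring grid points. *)
Lemma fine_grid (M : pseudoMetricType RR) (K : set M) (g : M -> RR * RR) :
  compact K -> continuous g -> (forall x, earring (g x)) ->
  exists N, forall n, (N < n)%N -> forall x, K x ->
    locally_exact d (g @` ball x (2 / n%:R)).
Proof.
move=> cK cg Eg.
have [|x Kx|r r0 rP] := @lebesgue_number M K (fun U => locally_exact d (g @` U)) cK.
- move=> U V UV [s sV]; exists s => _ _ [x Ux <-] [y Uy <-].
  by apply: sV; [exists x => //; exact: UV|exists y => //; exact: UV].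
- have [U gxU [s sU]] := dloc (Eg x).
  exists (g @^-1` U); first exact: cg.
  exists s => _ _ [y Uy <-] [z Uz <-]; exact: sU.
have r20 : 0 < r / 2 by rewrite divr_gt0.
have [N Nr] := invS_lt r20; exists N => n Nn x Kx.
have [s sP] := rP x Kx; exists s => _ _ [y xy <-] [z xz <-].
have nr : 2 / n%:R <= r.
  rewrite mulrC -ler_pdivlMr// (le_trans _ (ltW Nr))// lef_pV2 ?posrE ?ltr0n ?ler_nat//.
  exact: leq_trans Nn.
by apply: sP; [exists y|exists z] => //; apply: le_ball nr _ _.
Qed.

(** On each cell of the coarse grid [d] is a coboundary, so the [m] finer steps telescope to the
    coarse one. *)
Lemma steps_mul (n m : nat) g : (0 < n)%N -> (0 < m)%N -> (forall t, earring (g t)) ->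
  (forall x : RR, 0 <= x <= 1 -> locally_exact d (g @` ball x (2 / n%:R))) ->
  steps (n * m) g = steps n g.
Proof.
move=> n0 m0 Eg gn; rewrite /steps big_nat_mul; apply: eq_big_nat => i /= ni.
have nR : (0 : RR) < n%:R by rewrite ltr0n.
have mR : (0 : RR) < m%:R by rewrite ltr0n.
have [s sP] : locally_exact d (g @` ball (i%:R / n%:R : RR) (2 / n%:R)).
  apply: gn; rewrite divr_ge0//= ler_pdivrMr// mul1r ler_nat.
  exact/ltnW.
have E j : (j * m)%:R / (n * m)%:R = j%:R / n%:R :> RR.
  by rewrite !natrM; field; rewrite !gt_eqF.
have nm : (0 : RR) < (n * m)%:R^-1 by rewrite invr_gt0 ltr0n muln_gt0 n0.
have near_i j : (i * m <= j <= i.+1 * m)%N -> (g @` ball (i%:R / n%:R : RR) (2 / n%:R)) (g (j%:R / (n * m)%:R)).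
  move=> /andP[ij ji]; exists (j%:R / (n * m)%:R) => //.
  have uv : (i%:R / n%:R : RR) <= j%:R / (n * m)%:R.
    by rewrite -E ler_pM2r// ler_nat.
  have vu : j%:R / (n * m)%:R <= (i.+1%:R / n%:R : RR).
    by rewrite -E ler_pM2r// ler_nat.
  rewrite /ball/= distrC ger0_norm ?subr_ge0//.
  apply: le_lt_trans (lerB vu (lexx _)) _.
  by rewrite -mulrBl -natrB// subSnn ltr_pM2r ?invr_gt0// ltr1n.
transitivity (\sum_(i * m <= j < i.+1 * m) (s (g (j.+1%:R / (n * m)%:R)) - s (g (j%:R / (n * m)%:R)))).
  apply: eq_big_nat => j /andP[ij ji]; apply: sP => //; apply: near_i.
    by rewrite ij ltnW.
  by rewrite ji (leq_trans ij).
rewrite telescope_sumr; last by rewrite leq_mul2r leqnSn orbT.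
rewrite -sP//; last 2 first.
- by apply: near_i; rewrite leqnn leq_mul2r leqnSn orbT.
- by apply: near_i; rewrite leqnn leq_mul2r leqnSn orbT.
by rewrite !E.
Qed.

(** Two fine grids are compared through their common refinement. *)
Lemma steps_eventually (g : RR -> RR * RR) : continuous g -> (forall t, earring (g t)) ->
  exists N, forall n, (N < n)%N -> steps n g = steps N.+1 g.
Proof.
move=> cg Eg.
have [N NP] := fine_grid (@segment_compact _ (0 : RR) 1) cg Eg; exists N => n Nn.
have fine m : (N < m)%N -> forall x : RR, 0 <= x <= 1 -> locally_exact d (g @` ball x (2 / m%:R)).
  by move=> Nm x x01; apply: NP => //=; rewrite in_itv.
have n0 : (0 < n)%N by exact: leq_trans Nn.
rewrite -(@steps_mul n N.+1)//; last exact: fine.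
by rewrite mulnC (@steps_mul N.+1 n)//; exact: fine.
Qed.

(** Around a small grid square [d] sums to zero. Within a row the sides between adjacent squares
    telescope, and at both ends [H] stays at the origin, so neighbouring rows have equal sums. *)
Lemma steps_homotopy n (H : RR * RR -> RR * RR) : (0 < n)%N ->
  (forall x, earring (H x)) ->
  (forall s t : RR, 0 <= s <= 1 -> 0 <= t <= 1 ->
     locally_exact d (H @` ball (s, t) (2 / n%:R))) ->
  (forall s : RR, 0 <= s <= 1 -> H (s, 0) = origin /\ H (s, 1) = origin) ->
  steps n (fun t => H (0, t)) = steps n (fun t => H (1, t)).
Proof.
move=> n0 EH Hn H0.
have nR : (0 : RR) < n%:R by rewrite ltr0n.
pose x i : RR := i%:R / n%:R.
have x01 i : (i <= n)%N -> 0 <= x i <= 1.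
  by move=> ni; rewrite divr_ge0//= ler_pdivrMr// mul1r ler_nat.
have xS i : `|x i - x i.+1| < 2 / n%:R.
  rewrite /x -mulrBl -natr1 opprD addNKr normrM normrN1 mul1r.
  by rewrite ger0_norm ?invr_ge0// -[ltLHS]mul1r ltr_pM2r ?invr_gt0// ltr1n.
have xx i : `|x i - x i| < 2 / n%:R by rewrite subrr normr0 divr_gt0.
have dpp p : earring p -> d p p = 0.
  move=> Ep; have [U pU [s sU]] := dloc Ep.
  by rewrite (sU p p)// ?subrr//; exact: nbhs_singleton.
have row i : (i < n)%N -> steps n (fun t => H (x i, t)) = steps n (fun t => H (x i.+1, t)).
  move=> ni; apply/eqP; rewrite -subr_eq0 /steps -sumrB; apply/eqP.
  transitivity (\sum_(0 <= j < n) (- d (H (x i, x j.+1)) (H (x i.+1, x j.+1)) - - d (H (x i, x j)) (H (x i.+1, x j)))).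
    apply: eq_big_nat => j /= nj.
    have [s sP] := Hn (x i) (x j) (x01 _ (ltnW ni)) (x01 _ (ltnW nj)).
    have near_ij a b : `|x i - a| < 2 / n%:R -> `|x j - b| < 2 / n%:R ->
       (H @` ball (x i, x j) (2 / n%:R)) (H (a, b)).
      by move=> xa xb; exists (a, b).
    rewrite (sP (H (x i, x j)) (H (x i, x j.+1))) ?(sP (H (x i.+1, x j)) (H (x i.+1, x j.+1)))
      ?(sP (H (x i, x j.+1)) (H (x i.+1, x j.+1))) ?(sP (H (x i, x j)) (H (x i.+1, x j)))//;
      try exact: near_ij.
    by ring.
  rewrite telescope_sumr//.
  have -> : x n = 1 by rewrite /x divff// gt_eqF.
  have -> : x 0%N = 0 by rewrite /x mul0r.
  have [[-> ->] [-> ->]] := (H0 _ (x01 _ (ltnW ni)), H0 _ (x01 _ ni)).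
  by rewrite subrr.
have all_rows i : (i <= n)%N -> steps n (fun t => H (x 0%N, t)) = steps n (fun t => H (x i, t)).
  by elim: i => [//|i IH] ni; rewrite (IH (ltnW ni)) (row i ni).
have := all_rows n (leqnn n).
have -> : x n = 1 by rewrite /x divff// gt_eqF.
by have -> : x 0%N = 0 by rewrite /x mul0r.
Qed.


End Winding.

(** * Winding numbers of loops *)

Lemma within_comp (X M N : topologicalType) (A : set M) (f : M -> N) (h : X -> M) :
  {within A, continuous f} -> continuous h -> (forall x, A (h x)) -> continuous (f \o h).
Proof.
move=> /subspace_continuousP fA ch hA x; apply: cvg_comp (fA (h x) (hA x)) => U.
move=> WU; apply: (@filterS _ (nbhs x) _ _ _ _ (ch x _ WU)) => y /=.
by apply; exact: hA.
Qed.

(** Composition with [clamp] extends a loop to the whole line, turning continuity within [I01] into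
    plain continuity. *)
Definition clamp (R : realType) (t : R) : R := Num.min 1 (Num.max 0 t).

Lemma clampE (R : realType) (t : R) :
  clamp t = if t < 0 then 0 else if t <= 1 then t else 1.
Proof.
have [t0|t0] := ltP t 0; first by rewrite /clamp max_l ?ltW// min_r// ler01.
have [t1|t1] := leP t 1; first by rewrite /clamp max_r// min_r.
by rewrite /clamp max_r// min_l// ltW.
Qed.

Lemma clamp_continuous (R : realType) : continuous (@clamp R).
Proof.
move=> x; apply/cvgrPdist_lt => e e0; near=> y.
have : `|x - y| < e by near: y; apply/nbhs_ballP; exists e.
rewrite !ltr_norml => /andP[? ?]; rewrite !clampE.
by case: (ltP x 0) => ?; case: (ltP y 0) => ?; try (case: (leP x 1) => ?);
  try (case: (leP y 1) => ?); apply/andP; split; lra.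
Unshelve. all: by end_near. Qed.

Lemma clamp_id (R : realType) (t : R) : 0 <= t <= 1 -> clamp t = t.
Proof. by move=> /andP[t0 t1]; rewrite /clamp max_r// min_r. Qed.

Lemma clamp01 (R : realType) (t : R) : 0 <= clamp t <= 1.
Proof. by rewrite /clamp le_min ler01 le_max lexx/= ge_min lexx. Qed.

Lemma loop_clamp g : loop g -> continuous (g \o @clamp _) /\ forall t, earring (g (clamp t)).
Proof.
move=> [cg [Eg _]]; split=> [|t]; last exact/Eg/clamp01.
apply: (within_comp cg); first exact: clamp_continuous.
by move=> t; exact: clamp01.
Qed.

Lemma grid01 (i n : nat) : (i <= n)%N -> 0 <= (i%:R / n%:R : RR) <= 1.
Proof.
move=> ni; have [->|n0] := posnP n; first by rewrite invr0 mulr0 lexx ler01.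
by rewrite divr_ge0//= ler_pdivrMr ?ltr0n// mul1r ler_nat.
Qed.

Lemma eq_steps d n g h : (forall t, I01 t -> g t = h t) -> steps d n g = steps d n h.
Proof.
by move=> gh; apply: eq_big_nat => i /= ni; rewrite !gh//; apply: grid01 => //; exact: ltnW.
Qed.

(** The eventual value of the step sums over finer and finer grids, with default 0 if they do not
    stabilise. *)
Definition wind (k : nat) (g : RR -> RR * RR) : int :=
  xget 0 [set w | exists N, forall n, (N < n)%N -> steps (crossing k) n g = w].

Lemma windE k g w N : (forall n, (N < n)%N -> steps (crossing k) n g = w) -> wind k g = w.
Proof.
move=> NP; rewrite /wind; case: xgetP => [w' _ [N' N'P]|/(_ w)]; last by case; exists N.
by rewrite -(NP (maxn N N').+1) ?N'P// ltnS ?leq_maxl ?leq_maxr.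
Qed.

Lemma windP k g : (0 < k)%N -> loop g ->
  exists N, forall n, (N < n)%N -> steps (crossing k) n g = wind k g.
Proof.
move=> k0 lg; have [cg Eg] := loop_clamp lg.
have [N NP] := steps_eventually (fun p => crossing_locally_exact k0) cg Eg.
have gE n : steps (crossing k) n (g \o @clamp _) = steps (crossing k) n g.
  by apply: eq_steps => t t01 /=; rewrite clamp_id.
exists N => n Nn; rewrite (@windE _ _ (steps (crossing k) N.+1 g) N); last first.
  by move=> m Nm; rewrite -!gE NP.
by rewrite -!gE NP.
Qed.

Lemma wind_eq k a b : (0 < k)%N -> loop a -> loop b ->
  (exists N, forall n, (N < n)%N -> steps (crossing k) n a = steps (crossing k) n b) ->
  wind k a = wind k b.
Proof.
move=> k0 la lb [N NP]; have [Na aP] := windP k0 la; have [Nb bP] := windP k0 lb.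
pose n := (maxn N (maxn Na Nb)).+1.
rewrite -(aP n) -?(bP n) ?NP// /n ltnS ?leq_maxl// !leq_max leqnn ?orbT//.
Qed.

Lemma wind_homotopic k a b : (0 < k)%N -> loop a -> loop b -> loop_homotopic a b ->
  wind k a = wind k b.
Proof.
move=> k0 la lb [H [cH [EH [Hab H0]]]]; apply: wind_eq => //.
pose cl (x : RR * RR) := (clamp x.1, clamp x.2).
have ccl : continuous cl.
  move=> x; have c1 : clamp q.1 @[q --> x] --> clamp x.1.
    apply: (@cvg_comp _ _ _ fst (@clamp RR) (nbhs x) (nbhs x.1)).
      exact: cvg_fst.
    exact: clamp_continuous.
  have c2 : clamp q.2 @[q --> x] --> clamp x.2.
    apply: (@cvg_comp _ _ _ snd (@clamp RR) (nbhs x) (nbhs x.2)).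
      exact: cvg_snd.
    exact: clamp_continuous.
  exact: cvg_pair c1 c2.
have cHc : continuous (H \o cl).
  by apply: (within_comp cH ccl) => x; split; exact: clamp01.
have EHc x : earring (H (cl x)) by apply: EH; exact: clamp01.
have cK : compact ([set` `[(0 : RR), 1]] `*` [set` `[(0 : RR), 1]]).
  by apply: compact_setX; exact: segment_compact.
have [N NP] := fine_grid (fun p => crossing_locally_exact k0) cK cHc EHc.
exists N => n Nn.
have -> : steps (crossing k) n a = steps (crossing k) n (fun t => (H \o cl) (0, t)).
  by apply: eq_steps => t t01; rewrite /= /cl/= !clamp_id ?lexx ?ler01//; case: (Hab t t01).
have -> : steps (crossing k) n b = steps (crossing k) n (fun t => (H \o cl) (1, t)).
  by apply: eq_steps => t t01; rewrite /= /cl/= !clamp_id ?lexx ?ler01//; case: (Hab t t01).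
apply: (steps_homotopy (fun p => crossing_locally_exact k0)) => //.
- exact: leq_ltn_trans Nn.
- move=> s t s01 t01; apply: (NP n Nn (s, t)).
  by split; rewrite /= in_itv.
- move=> s s01; rewrite /= /cl/= !clamp_id ?lexx ?ler01//.
  exact: H0.
Qed.

Lemma steps_concat d n a b : (0 < n)%N -> a 1 = origin -> b 0 = origin ->
  steps d (n + n) (loop_concat a b) = steps d n a + steps d n b.
Proof.
move=> n0 a1 b0; rewrite /steps (big_cat_nat _ (n := n)) ?leq_addr//=.
have nR : (0 : RR) < n%:R by rewrite ltr0n.
have half : 2^-1 * (n%:R + n%:R) = n%:R :> RR by field.
have left i : (i <= n)%N -> loop_concat a b (i%:R / (n + n)%:R) = a (i%:R / n%:R).
  move=> ni; rewrite /loop_concat natrD ifT.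
    by congr a; field; rewrite ?gt_eqF// addr_gt0.
  by rewrite ler_pdivrMr ?addr_gt0// half ler_nat.
have right i : loop_concat a b ((n + i)%:R / (n + n)%:R) = b (i%:R / n%:R).
  (* At the midpoint [loop_concat] still evaluates [a], so the two endpoint values must agree. *)
  have [->|i0] := posnP i; first by rewrite addn0 left// divff ?gt_eqF// mul0r a1 b0.
  rewrite /loop_concat !natrD ifF.
    by congr b; field; rewrite ?gt_eqF// addr_gt0.
  apply/negbTE; rewrite -ltNge ltr_pdivlMr ?addr_gt0// half.
  by rewrite ltrDl ltr0n.
congr (_ + _).
  by apply: eq_big_nat => i /= ni; rewrite !left// ltnW.
rewrite -{1}[n]add0n big_addn addnK; apply: eq_big_nat => i _.
by rewrite addnC -addnS !right.
Qed.

Lemma wind_concat k a b : (0 < k)%N -> loop a -> loop b -> loop (loop_concat a b) ->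
  wind k (loop_concat a b) = wind k a + wind k b.
Proof.
move=> k0 la lb lab.
have [[Na aP] [Nb bP]] := (windP k0 la, windP k0 lb); have [N NP] := windP k0 lab.
pose n := (maxn N (maxn Na Nb)).+1.
rewrite -(NP (n + n)%N); last by rewrite ltn_addr// /n ltnS leq_maxl.
rewrite steps_concat//; [|by case: la => _ [_ []]|by case: lb => _ [_ []]].
by rewrite aP ?bP// /n ltnS !leq_max leqnn ?orbT.
Qed.

(** For loops on the whole line that rest at the origin outside [[0, 1]], concatenation is a sum of
    two rescaled loops, at most one of which is moving at any time. Its continuity is then
    immediate. *)
Definition cloop (g : RR -> RR * RR) : Prop :=
  [/\ continuous g, forall t, earring (g t), forall t, t <= 0 -> g t = 0 &
      forall t, 1 <= t -> g t = 0].

Lemma eq_loop g h : (forall t, I01 t -> g t = h t) -> loop g -> loop h.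
Proof.
move=> gh [cg [Eg [g0 g1]]].
have I0 : I01 0 by rewrite /I01/= lexx ler01.
have I1 : I01 1 by rewrite /I01/= lexx ler01.
split; first by apply: subspace_eq_continuous cg => t /set_mem; exact: gh.
by rewrite -!gh//; split=> // t t01; rewrite -gh//; exact: Eg.
Qed.

Lemma cloop_loop g : cloop g -> loop g.
Proof.
move=> [cg Eg g0 g1]; split; first exact: continuous_subspaceT.
by split=> //; rewrite g0 ?g1.
Qed.

Lemma clamp_cloop g : loop g -> cloop (g \o @clamp _).
Proof.
move=> lg; have [cg Eg] := loop_clamp lg; have [_ [_ [g0 g1]]] := lg.
split=> // t t0; rewrite /= clampE.
  by have [//|t0'] := ltP t 0; have -> : t = 0 by [apply/eqP; rewrite eq_le t0]; rewrite ler01.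
rewrite ltNge (le_trans ler01 t0)/=; have [t1|//] := leP t 1.
by have -> : t = 1 by apply/eqP; rewrite eq_le t1.
Qed.

Lemma loop_concatE a b t : cloop a -> cloop b ->
  loop_concat a b t = a (2 * t) + b (2 * t - 1).
Proof.
move=> [_ _ a0 a1] [_ _ b0 b1]; rewrite /loop_concat; case: leP => t2.
  by rewrite (b0 (2 * t - 1)) ?addr0//; lra.
by rewrite (a1 (2 * t)) ?add0r//; lra.
Qed.

Lemma linear_continuous_comp (R : realType) (X : topologicalType) (f : R -> X) (a b : R) :
  continuous f -> continuous (fun t => f (a * t + b)).
Proof.
move=> cf t; apply: (@cvg_comp _ _ _ (fun t => a * t + b) f _ (nbhs (a * t + b))); last exact: cf.
by apply: cvgD; [apply: cvgMr; exact: cvg_id|exact: cvg_cst].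
Qed.

Lemma continuousD2 (R : realType) (X : topologicalType) (f g : X -> R * R) :
  continuous f -> continuous g -> continuous (fun x => f x + g x).
Proof. by move=> cf cg x; apply: (@cvgD R (R * R)%type _ _ _ f g); [exact: cf|exact: cg]. Qed.

Lemma concat_cloop a b : cloop a -> cloop b -> cloop (loop_concat a b).
Proof.
move=> la lb; have [ca Ea a0 a1] := la; have [cb Eb b0 b1] := lb.
have abE : loop_concat a b = (fun t => a (2 * t + 0) + b (2 * t + -1)).
  by apply/funext => t; rewrite loop_concatE// addr0.
split.
- by rewrite abE; apply: continuousD2; exact: linear_continuous_comp.
- by move=> t; rewrite /loop_concat; case: ifP.
- by move=> t t0; rewrite abE a0 ?b0 ?addr0//; lra.
- by move=> t t0; rewrite abE a1 ?b1 ?addr0//; lra.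
Qed.

Lemma concat_loop a b : loop a -> loop b -> loop (loop_concat a b).
Proof.
move=> la lb; apply: eq_loop (cloop_loop (concat_cloop (clamp_cloop la) (clamp_cloop lb))).
move=> t /andP[t0 t1]; rewrite /loop_concat /=; case: leP => t2; rewrite clamp_id//.
  by apply/andP; split; lra.
by apply/andP; split; lra.
Qed.

(* The point in direction [v] from the origin on the circle of radius [1/k]
   centred at [(0, 1/k)]. *)
Definition ray (R : realType) (k : R) (v : R * R) : R * R :=
  let c := 2 * v.2 / (k * (v.1 ^+ 2 + v.2 ^+ 2)) in (c * v.1, c * v.2).

Lemma ray_cvg (R : realType) (k : R) (v : R * R) : 0 < k -> v != 0 ->
  ray k w @[w --> v] --> ray k v.
Proof.
move=> k0 v0; have n0 : k * (v.1 ^+ 2 + v.2 ^+ 2) != 0.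
  apply: mulf_neq0; first by rewrite gt_eqF.
  rewrite paddr_eq0 ?sqr_ge0// !expf_eq0/=.
  by apply: contra v0; case: v => a b /= /andP[/eqP-> /eqP->].
have c1 : fst w @[w --> v] --> v.1 by exact: cvg_fst.
have c2 : snd w @[w --> v] --> v.2 by exact: cvg_snd.
have C : 2 * w.2 / (k * (w.1 ^+ 2 + w.2 ^+ 2)) @[w --> v] -->
    2 * v.2 / (k * (v.1 ^+ 2 + v.2 ^+ 2)).
  apply: cvgM; first exact: cvgMr.
  by apply: cvgV => //; apply: cvgMr; apply: cvgD; exact: cvgM.
exact: (cvg_pair (cvgM C c1) (cvgM C c2)).
Qed.

Lemma ray_snd0 (R : realType) k (v : R * R) : v.2 = 0 -> ray k v = 0.
Proof. by move=> v2; rewrite /ray v2 !(mulr0, mul0r). Qed.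

Lemma ray_circle k (v : RR * RR) : (0 < k)%N -> circle k (ray k%:R v).
Proof.
move=> k0; have k0' : (k%:R : RR) != 0 by rewrite pnatr_eq0 -lt0n.
apply/circleE => //; rewrite /ray/=; have [v2|v2] := eqVneq v.2 0.
  by rewrite v2 !(mulr0, mul0r) expr0n/= addr0 mulr0.
by field; rewrite k0' /= gt_eqF// sqr_sum_gt0.
Qed.

Lemma ray_earring k v : (0 < k)%N -> earring (ray k%:R v).
Proof. by move=> k0; exists k; split=> //; exact: ray_circle. Qed.

Lemma ray_snd_gt0 k (v : RR * RR) : (0 < k)%N -> v.2 != 0 -> 0 < (ray k%:R v).2.
Proof.
move=> k0 v2; rewrite /ray/= (_ : _ * v.2 = 2 * v.2 ^+ 2 / (k%:R * (v.1 ^+ 2 + v.2 ^+ 2))); last by ring.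
rewrite divr_gt0//.
  by rewrite mulr_gt0// exprn_even_gt0.
by rewrite mulr_gt0 ?ltr0n// sqr_sum_gt0.
Qed.

(** Seen from the origin, the upper half of each circle lies in the directions steeper than 45
    degrees. *)
Lemma top_ray k n (v : RR * RR) : (0 < n)%N -> 
  top k (ray n%:R v) = (k == n) && (v.1 ^+ 2 < v.2 ^+ 2).
Proof.
move=> n0; have [v2|v2] := eqVneq v.2 0.
  by rewrite ray_snd0// v2 /top /= mulr0 ltr10 andbF expr0n/= ltNge sqr_ge0 andbF.
have r2 := ray_snd_gt0 n0 v2.
have /(circle_kappa n0)/proj1/(_ (ray_circle v n0)) E : (ray n%:R v).2 != 0 by rewrite gt_eqF.
rewrite /top E eqr_nat eq_sym; have [->|//] := eqVneq k n => /=.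
have q0 := sqr_sum_gt0 v2; have n0' : (n%:R : RR) != 0 by rewrite pnatr_eq0 -lt0n.
rewrite (_ : _ * _ = 2 * v.2 ^+ 2 / (v.1 ^+ 2 + v.2 ^+ 2)); last first.
  by rewrite /ray/=; field; rewrite n0' gt_eqF.
by rewrite ltr_pdivlMr// mul1r; apply/idP/idP; lra.
Qed.

Lemma east_ray n (v : RR * RR) : (0 < n)%N -> 0 < v.2 ->
  east (ray n%:R v) = if 0 <= v.1 then 1 else 0.
Proof.
move=> n0 v2; rewrite /east /ray/= pmulr_rge0//.
by rewrite divr_gt0 ?mulr_gt0 ?ltr0n// sqr_sum_gt0// gt_eqF.
Qed.

(** * Loops around a single circle *)

Lemma clamp_prod_continuous (R : realType) : continuous (fun t : R => clamp t * (1 - clamp t)).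
Proof.
move=> t; have C := @clamp_continuous R t.
by apply: cvgM => //; apply: cvgB => //; exact: cvg_cst.
Qed.

(** The direction turns from west through north to east. Clamping annihilates its second coordinate
    outside [[0, 1]], where [ray] then gives the origin. *)
Definition circle_loop (n : nat) (t : RR) : RR * RR :=
  ray n%:R (2 * t - 1, clamp t * (1 - clamp t)).

Lemma circle_loop_cloop n : (0 < n)%N -> cloop (circle_loop n).
Proof.
move=> n0; split.
- move=> t; apply: (@cvg_comp _ _ _ (fun t : RR => (2 * t - 1, clamp t * (1 - clamp t))) (ray n%:R)
      (nbhs t) (nbhs (2 * t - 1, clamp t * (1 - clamp t)))).
    apply: (@cvg_pair _ _ _ _ (nbhs (2 * t - 1)) (nbhs (clamp t * (1 - clamp t)))).
      by apply: (@linear_continuous_comp RR RR id 2 (-1)) => x; exact: cvg_id.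
    exact: (clamp_prod_continuous (R := RR)).
  apply: ray_cvg; first by rewrite ltr0n.
  apply/eqP => -[t2]; rewrite clamp_id; last by apply/andP; split; lra.
  by nra.
- by move=> t; exact: ray_earring.
- move=> t t0; apply: ray_snd0 => /=; rewrite clampE; case: (ltP t 0) => t0'.
    by rewrite mul0r.
  by have -> : t = 0 by [apply/eqP; rewrite eq_le t0]; rewrite ler01 mul0r.
- move=> t t1; apply: ray_snd0 => /=; rewrite clampE ltNge (le_trans ler01 t1)/=.
  case: (leP t 1) => t1'; last by rewrite subrr mulr0.
  by have -> : t = 1 by [apply/eqP; rewrite eq_le t1']; rewrite subrr mulr0.
Qed.

(** The loop passes once through the upper half of its circle, going east, and the crossings add up
    to the jump of [s] at [1/2]. *)
Lemma wind_circle_loop k n : (0 < k)%N -> (0 < n)%N -> wind k (circle_loop n) = (k == n)%:R.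
Proof.
move=> k0 n0; have [<-|kn] := eqVneq k n; last first.
  apply: (@windE _ _ _ 0) => m _; rewrite /steps big1_seq// => i _.
  by rewrite /crossing top_ray// (negPf kn).
pose s (t : RR) : int := if 2^-1 <= t then 1 else 0.
(* A step shorter than [1/16] across [1/2] stays within [[7/16, 9/16]], where the direction is steep
   enough for both ends to count as top. *)
apply: (@windE _ _ _ 16) => m m16.
have mR : (0 : RR) < m%:R by rewrite ltr0n (leq_trans _ m16).
transitivity (\sum_(0 <= i < m) (s (i.+1%:R / m%:R) - s (i%:R / m%:R))).
  apply: eq_big_nat => i /= im; rewrite /crossing !top_ray// eqxx/=.
  have := grid01 (ltnW im); have := grid01 im.
  have : i.+1%:R / m%:R < i%:R / m%:R + 1/16 :> RR.
    rewrite -natr1 mulrDl ltrD2l ltr_pdivrMr// mulrC mulrA mulr1 ltr_pdivlMr// mul1r.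
    by rewrite (ltr_nat _ 16 m).
  have : i%:R / m%:R < i.+1%:R / m%:R :> RR.
    by rewrite ltr_pM2r ?invr_gt0// ltr_nat.
  move: (i%:R / m%:R) (i.+1%:R / m%:R) => t t' tt' t't /andP[t'0 t'1] /andP[t0 t1].
  rewrite !clamp_id ?t0 ?t'0//.
  have eastE (u : RR) : 0 <= u -> u <= 1 -> (2 * u - 1) ^+ 2 < (u * (1 - u)) ^+ 2 ->
      east (circle_loop k u) = s u.
    move=> u0 u1 uu; rewrite /circle_loop clamp_id ?u0// east_ray//=.
      by rewrite /s; congr (if _ then _ else _); apply/idP/idP; lra.
    rewrite lt_neqAle mulr_ge0 ?subr_ge0// andbT eq_sym; apply/eqP => u2.
    by move: uu; rewrite u2 expr0n/= ltNge sqr_ge0.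
  have [/andP[top1 top2]|ntop] := boolP (_ && _); first by rewrite !eastE.
  rewrite /s; case: (leP 2^-1 t) => ht; case: (leP 2^-1 t') => ht'; rewrite ?subrr//; exfalso; first lra.
  have sq (u : RR) : 7/16 <= u -> u <= 9/16 -> (2 * u - 1) ^+ 2 < (u * (1 - u)) ^+ 2.
    move=> u1 u2; have b1 : 7/32 <= u * (1 - u) by nra.
    by nra.
  by case/negP: ntop; rewrite !sq//; lra.
rewrite telescope_sumr// mul0r divff ?gt_eqF// /s.
rewrite ifT; last lra.
by rewrite ifF//; apply/negbTE; rewrite -ltNge; lra.
Qed.

Lemma nslender_tfr (A : zmodType) : nslender A -> torsion_free_reduced A.
Proof.
move=> nsA; apply: contrapT => /not_tfr_seq_hom[a a0 [f fD fe]].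
pose W (g : RR -> RR * RR) : nat -> int := fun i => wind i.+1 g.
have [||N NP] := nsA (fun g => f (W g)).
- move=> g h lg lh gh; congr f; apply/funext => i.
  exact: wind_homotopic.
- move=> g h lg lh; rewrite -fD; congr f; apply/funext => i.
  by rewrite /W wind_concat//; exact: concat_loop.
(* Circles are numbered from 1 and coordinates from 0: the loop around circle [N.+1], which
   [retractN N] collapses, has winding vector [eseq N]. *)
apply: a0; rewrite -(fe N).
have -> : eseq N = W (circle_loop N.+1).
  by apply/funext => i; rewrite /W wind_circle_loop// eqSS.
rewrite NP; last exact/cloop_loop/circle_loop_cloop.
rewrite -(hom0 fD); congr f; apply/funext => i.
apply: (@windE _ _ _ 0) => m _; rewrite /steps big1_seq// => j _.
have top0 t : top i.+1 (retractN N (circle_loop N.+1 t)) = false.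
  rewrite /retractN; case: asboolP => [[n [/andP[n0 nN] nt]]|_].
    have [t2|t2] := eqVneq (circle_loop N.+1 t).2 0.
      by rewrite /top t2 mulr0 ltr10 andbF.
    have := (circle_kappa n0 t2).1 nt.
    rewrite ((circle_kappa (ltn0Sn N) t2).1 (ray_circle _ (ltn0Sn N))) => /eqP.
    by rewrite eqr_nat => /eqP nE; move: nN; rewrite -nE ltnn.
  by rewrite /top /= mulr0 ltr10 andbF.
by rewrite /crossing /= top0.
Qed.

(** * Splitting a loop of the earring *)

Lemma continuous_loop (h : RR -> RR * RR) : continuous h -> (forall t, earring (h t)) -> h 0 = 0 -> h 1 = 0 -> loop h.
Proof. by move=> ch Eh h0 h1; split; first exact: continuous_subspaceT. Qed.

(** On [[0, 1]] the formula runs linearly from [a] to [c] in the first half and from [c] to [b] in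
    the second. *)
Lemma switch_continuous (R : realType) (a b c : R) :
  continuous (fun t : R => a + (c - a) * clamp (2 * t) + (b - c) * clamp (2 * t - 1)).
Proof.
move=> t; have C k : clamp (2 * s + k) @[s --> t] --> clamp (2 * t + k).
  exact: (linear_continuous_comp (@clamp_continuous R)).
have C0 : clamp (2 * s) @[s --> t] --> clamp (2 * t).
  by rewrite -[2 * t]addr0; under eq_fun do rewrite -[2 * _]addr0; exact: C.
by apply: cvgD; [apply: cvgD; [exact: cvg_cst|exact: cvgMr]|apply: cvgMr; exact: C].
Qed.

(** This is the straight-line homotopy from the affine path between [a] and [b] to [tau]. *)
Lemma interpolate_continuous (R : realType) (a b : R) (tau : R -> R) : continuous tau ->
  continuous (fun x : R * R => (1 - x.1) * (a + (b - a) * x.2) + x.1 * tau x.2).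
Proof.
move=> ctau x.
have c1 : fst w @[w --> x] --> x.1 by exact: cvg_fst.
have c2 : snd w @[w --> x] --> x.2 by exact: cvg_snd.
have c3 : tau (snd w) @[w --> x] --> tau x.2.
  by apply: (@cvg_comp _ _ _ snd tau (nbhs x) (nbhs x.2)); [exact: cvg_snd|exact: ctau].
apply: cvgD; apply: cvgM => //; first by apply: cvgB => //; exact: cvg_cst.
by apply: cvgD; [exact: cvg_cst|exact: cvgMr].
Qed.

Section LoopMorphism.
Variables (A : zmodType) (phi : (RR -> RR * RR) -> A).
Hypothesis phi_homotopic : forall a b, loop a -> loop b -> loop_homotopic a b -> phi a = phi b.
Hypothesis phi_concat : forall a b, loop a -> loop b -> phi (loop_concat a b) = phi a + phi b.

Lemma phi_homotopy a b (H : RR * RR -> RR * RR) : loop a -> loop b -> continuous H ->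
  (forall x, earring (H x)) ->
  (forall t, I01 t -> H (0, t) = a t /\ H (1, t) = b t) ->
  (forall s, H (s, 0) = 0 /\ H (s, 1) = 0) -> phi a = phi b.
Proof.
move=> la lb cH EH Hab H0; apply: phi_homotopic => //; exists H; split.
  exact: continuous_subspaceT.
by split; [move=> *; exact: EH|split].
Qed.

Lemma eq_phi a b : loop a -> (forall t, I01 t -> a t = b t) -> phi a = phi b.
Proof.
move=> la ab; have lb : loop b := eq_loop ab la.
have [ca Ea a0 a1] := clamp_cloop la.
apply: (phi_homotopy (H := (a \o @clamp RR) \o snd)) => //.
- move=> x; apply: (@cvg_comp _ _ _ snd (a \o @clamp RR) (nbhs x) (nbhs x.2)).
    exact: cvg_snd.
  exact: ca.
- by move=> x; exact: Ea.
- by move=> t t01 /=; rewrite clamp_id// ab.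
- by move=> s; split; [exact: a0|exact: a1].
Qed.

Lemma loop0 : loop (fun=> 0).
Proof. by apply: continuous_loop => // [x|_]; [exact: cvg_cst|exact: earring_origin]. Qed.

Lemma phi0 : phi (fun=> 0) = 0.
Proof.
have := phi_concat loop0 loop0.
have -> : loop_concat (fun=> 0) (fun=> 0) = (fun=> 0).
  by apply/funext => t; rewrite /loop_concat; case: ifP.
by move=> /eqP; rewrite -subr_eq0 opprD addNKr oppr_eq0 => /eqP.
Qed.

Definition subpath (g : RR -> RR * RR) (a b t : RR) := g (a + (b - a) * t).

Lemma subpath_loop g a b : cloop g -> g a = 0 -> g b = 0 -> loop (subpath g a b).
Proof.
move=> [cg Eg _ _] ga gb; apply: continuous_loop.
- have -> : subpath g a b = fun t => g ((b - a) * t + a).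
    by apply/funext => t; rewrite /subpath addrC.
  exact: linear_continuous_comp.
- by move=> t; exact: Eg.
- by rewrite /subpath mulr0 addr0.
- by rewrite /subpath mulr1 addrC subrK.
Qed.

(** Both sides follow [g] along different parametrisations from [a] to [b], and a straight-line
    homotopy of the parameters joins them. *)
Lemma phi_subpath g a c b : cloop g -> g a = 0 -> g c = 0 -> g b = 0 ->
  phi (subpath g a b) = phi (subpath g a c) + phi (subpath g c b).
Proof.
move=> lg ga gc gb; have [cg Eg _ _] := lg.
have [lab lac lcb] : [/\ loop (subpath g a b), loop (subpath g a c) & loop (subpath g c b)].
  by split; exact: subpath_loop.
rewrite -phi_concat//.
pose tau t := a + (c - a) * clamp (2 * t) + (b - c) * clamp (2 * t - 1).
have ctau : continuous tau by exact: (@switch_continuous RR).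
pose h (x : RR * RR) := (1 - x.1) * (a + (b - a) * x.2) + x.1 * tau x.2.
have ch : continuous h by exact: (@interpolate_continuous RR).
have cl0 (t : RR) : t <= 0 -> clamp t = 0.
  move=> t0; rewrite clampE; case: ltP => // t0'.
  by have -> : t = 0 by [apply/eqP; rewrite eq_le t0]; rewrite ler01.
have cl1 (t : RR) : 1 <= t -> clamp t = 1.
  move=> t1; rewrite clampE ltNge (le_trans ler01 t1)/=; case: leP => // t1'.
  by apply/eqP; rewrite eq_le t1'.
apply: (phi_homotopy (H := g \o h)) => //.
- exact: concat_loop.
- move=> x; apply: (@cvg_comp _ _ _ h g (nbhs x) (nbhs (h x))); first exact: ch.
  exact: cg.
- by move=> x; exact: Eg.
- move=> t /andP[t0 t1]; split; rewrite /= /h /=.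
    by rewrite subr0 mul1r mul0r addr0.
  rewrite subrr mul0r add0r mul1r /tau /loop_concat /subpath; case: leP => t2.
    by rewrite (cl0 (2 * t - 1)) ?mulr0 ?addr0 ?clamp_id//; [apply/andP; split|]; lra.
  by rewrite (cl1 (2 * t)) ?clamp_id//; [congr g; ring|apply/andP; split; lra|lra].
- move=> s; split; rewrite /= /h /=.
    rewrite /tau !mulr0 addr0 cl0// cl0 ?mulr0 ?addr0; last lra.
    by rewrite -[RHS]ga; congr g; ring.
  rewrite /tau !mulr1 cl1; last lra.
  by rewrite cl1; [rewrite -[RHS]gb; congr g; ring|lra].
Qed.

(** By a Lebesgue number, [[0, 1]] splits into finitely many intervals on each of which [u] or [w]
    vanishes. Cutting where the vanishing loop changes, so that both are at the origin, leaves
    pieces of [g] that are pieces of [u] or of [w]. *)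
Lemma phi_disjoint_sum g u w : cloop g -> cloop u -> cloop w ->
  (forall t, g t = u t + w t) ->
  (forall t : RR, exists2 U, nbhs t U & (forall t', U t' -> u t' = 0) \/ (forall t', U t' -> w t' = 0)) ->
  phi g = phi u + phi w.
Proof.
move=> lg lu lw guw loc.
have [|x _|r r0 rP] := @lebesgue_number RR [set` `[(0 : RR), 1]]
  (fun U => (forall t', U t' -> u t' = 0) \/ (forall t', U t' -> w t' = 0)) (@segment_compact _ _ _).
- by move=> U V UV [V0|V0]; [left|right] => t' /UV; exact: V0.
- exact: loc.
have [k kr] := invS_lt r0; pose n := k.+1; pose x i : RR := i%:R / n%:R.
have x0 : x 0%N = 0 by rewrite /x mul0r.
have x1 : x n = 1 by rewrite /x divff ?pnatr_eq0.
have step i : (i < n)%N -> (forall t, x i <= t <= x i.+1 -> u t = 0) \/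
    (forall t, x i <= t <= x i.+1 -> w t = 0).
  move=> ni; have /(_ (x i)) := rP; rewrite /= in_itv/= grid01 ?(ltnW ni)// => /(_ isT).
  have xir t : x i <= t <= x i.+1 -> ball (x i) r t.
    move=> /andP[it ti]; rewrite /ball/= distrC ger0_norm ?subr_ge0//.
    apply: le_lt_trans kr; apply: le_trans (lerB ti (lexx _)) _.
    by rewrite /x -mulrBl -natrB// subSnn mul1r.
  by move=> [H|H]; [left|right] => t /xir; exact: H.
pose add b := phi (subpath g 0 b) = phi (subpath u 0 b) + phi (subpath w 0 b).
have [_ _ g0' g1'] := lg; have [_ _ u0' u1'] := lu; have [_ _ w0' w1'] := lw.
(* All three loops are at the origin at the times [a] and [b], so [phi_subpath] splits each of them
   at [a]. *)
have addS a b : a <= b -> u a = 0 -> w a = 0 -> u b = 0 -> w b = 0 -> add a ->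
    (forall t, a <= t <= b -> u t = 0) \/ (forall t, a <= t <= b -> w t = 0) -> add b.
  move=> ab ua wa ub wb adda uw.
  have g_ c : u c = 0 -> w c = 0 -> g c = 0 by rewrite guw => -> ->; rewrite addr0.
  have [u0 w0] : u 0 = 0 /\ w 0 = 0 by rewrite u0' ?w0'.
  rewrite /add (@phi_subpath g 0 a b)// ?g_// (@phi_subpath u 0 a b)// (@phi_subpath w 0 a b)//.
  rewrite adda [RHS]addrACA; congr (_ + _).
  have in_ab t : I01 t -> a <= a + (b - a) * t <= b.
    by move=> /andP[t0 t1]; apply/andP; split; nra.
  have zero (v : RR -> RR * RR) : cloop v -> v a = 0 -> v b = 0 ->
      (forall t, a <= t <= b -> v t = 0) -> phi (subpath v a b) = 0.
    move=> lv va vb v0; rewrite -phi0; apply: eq_phi; first exact: subpath_loop.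
    by move=> t /in_ab; exact: v0.
  have lgab : loop (subpath g a b) by apply: subpath_loop => //; exact: g_.
  case: uw => [u_0|w_0].
    rewrite (zero u)// add0r; apply: eq_phi => // t /in_ab t_ab.
    by rewrite /subpath guw u_0// add0r.
  rewrite (zero w)// addr0; apply: eq_phi => // t /in_ab t_ab.
  by rewrite /subpath guw w_0// addr0.
have xle i j : (i <= j)%N -> x i <= x j by move=> ij; rewrite /x ler_pM2r ?invr_gt0// ler_nat.
(* [x j] is the last cut; between it and [x i] one and the same loop has stayed at the origin. *)
have Q i : (i <= n)%N -> exists j, [/\ (j <= i)%N, u (x j) = 0, w (x j) = 0, add (x j) &
    (forall t, x j <= t <= x i -> u t = 0) \/ (forall t, x j <= t <= x i -> w t = 0)].
  elim: i => [_|i IH ni].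
    exists 0%N; rewrite x0 u0' ?w0'//; split=> //; last first.
      by left => t /andP[t0 t1]; rewrite u0'.
    have sub0 v : cloop v -> phi (subpath v 0 0) = 0.
      move=> [_ _ v0 _]; rewrite -[RHS]phi0; congr phi; apply/funext => t.
      by rewrite /subpath subrr mul0r addr0 v0.
    by rewrite /add !sub0// addr0.
  have [j [ji uj wj addj uw]] := IH (ltnW ni).
  have glue (v : RR -> RR * RR) : (forall t, x j <= t <= x i -> v t = 0) ->
      (forall t, x i <= t <= x i.+1 -> v t = 0) -> forall t, x j <= t <= x i.+1 -> v t = 0.
    move=> v1 v2 t /andP[jt ti]; have [it|it] := leP t (x i); first by rewrite v1// jt.
    by rewrite v2// ti ltW.
  have xji : x j <= x i <= x i by rewrite lexx xle.
  have xii : x i <= x i <= x i.+1 by rewrite lexx xle.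
  (* If the vanishing loop changes at [x i], both vanish there and [x i] is the next cut. *)
  case: uw (step i ni) => [u1|w1] [u2|w2].
  - by exists j; split=> //; [exact: leqW|left; exact: glue].
  - exists i; split=> //; [exact: u1|exact: w2| |by right].
    by apply: (addS (x j)) => //; [exact: xle|exact: u1|exact: w2|left].
  - exists i; split=> //; [exact: u2|exact: w1| |by left].
    by apply: (addS (x j)) => //; [exact: xle|exact: u2|exact: w1|right].
  - by exists j; split=> //; [exact: leqW|right; exact: glue].
have [j [jn uj wj addj uw]] := Q n (leqnn n).
have : add 1 by rewrite -x1; apply: (addS (x j)) => //; rewrite ?x1 ?u1' ?w1'//; rewrite -x1; exact: xle.
have sub1 v : subpath v 0 1 = v by apply/funext => t; rewrite /subpath subr0 mul1r add0r.
by rewrite /add !sub1.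
Qed.
End LoopMorphism.

(** * Continuous deformations of the earring *)

Definition sqn (R : realType) (p : R * R) : R := p.1 ^+ 2 + p.2 ^+ 2.

Lemma sqn_cvg0 (R : realType) (T : Type) (F : set_system T) (FF : Filter F) (f g : T -> R * R) :
  (forall t, sqn (f t) <= sqn (g t)) -> g t @[t --> F] --> (0 : R * R) ->
  f t @[t --> F] --> (0 : R * R).
Proof.
move=> fg g0.
have c1 : (g t).1 @[t --> F] --> (0 : R).
  by apply: (@cvg_comp _ _ _ g fst F (nbhs (0 : R * R))) => //; exact: cvg_fst.
have c2 : (g t).2 @[t --> F] --> (0 : R).
  by apply: (@cvg_comp _ _ _ g snd F (nbhs (0 : R * R))) => //; exact: cvg_snd.
have small e : 0 < e -> \forall t \near F, sqn (g t) < e ^+ 2.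
  move=> e0; have e2 : 0 < e / 2 by rewrite divr_gt0.
  move/cvgrPdist_lt : c1 => /(_ _ e2) h1; move/cvgrPdist_lt : c2 => /(_ _ e2) h2.
  near=> t.
  have : `|0 - (g t).1| < e / 2 by near: t.
  have : `|0 - (g t).2| < e / 2 by near: t.
  rewrite !sub0r !normrN !ltr_norml => /andP[? ?] /andP[? ?].
  rewrite /sqn; nra.
have coord (h : R * R -> R) : (forall p, h p ^+ 2 <= sqn p) -> h (f t) @[t --> F] --> (0 : R).
  move=> hp; apply/cvgrPdist_lt => e e0; apply: filterS (small e e0) => t gt.
  rewrite sub0r normrN -(@ltr_pXn2r _ 2) ?nnegrE ?(ltW e0)//.
  by rewrite real_normK ?num_real// (le_lt_trans (hp _))// (le_lt_trans (fg t)).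
have -> : f = fun t => ((f t).1, (f t).2) by apply/funext => t; case: (f t).
apply: (cvg_pair (G := nbhs (0 : R)) (H := nbhs (0 : R))).
  by apply: coord => p; rewrite /sqn lerDl sqr_ge0.
by apply: coord => p; rewrite /sqn lerDr sqr_ge0.
Unshelve. all: by end_near. Qed.

(* A circle minus the origin is open in the earring, so continuity can be tested
   circle by circle away from the origin. *)
Lemma continuous_circlewise (X : topologicalType) (g f : X -> RR * RR) :
  continuous g -> (forall x, earring (g x)) -> (forall x, sqn (f x) <= sqn (g x)) ->
  (forall x, (g x).2 != 0 -> exists2 f' : X -> RR * RR, f' y @[y --> x] --> f x &
     forall y, (g y).2 != 0 -> kappa (g y) = kappa (g x) -> f y = f' y) ->
  continuous f.
Proof.
move=> cg Eg fg loc x; have [gx|gx] := eqVneq (g x).2 0.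
  have gx0 : g x = 0 by exact: earring_snd0.
  have fx0 : f x = 0.
    have := fg x; rewrite gx0 /sqn/= expr0n/= addr0 => s0.
    have /eqP := le_anti (introT andP (conj s0 (addr_ge0 (sqr_ge0 (f x).1) (sqr_ge0 (f x).2)))).
    rewrite paddr_eq0 ?sqr_ge0// !sqrf_eq0 => /andP[/eqP f1 /eqP f2].
    by rewrite [f x]surjective_pairing f1 f2.
  rewrite /continuous_at fx0; apply: sqn_cvg0 fg _; rewrite -gx0; exact: cg.
have [f' f'x ff'] := loc x gx.
apply: cvg_trans f'x; apply: near_eq_cvg.
apply: (@filterS _ (nbhs x) _ _ _ _ (cg x _ (near_earring_kappa (Eg x) gx))).
move=> y /= /(_ (Eg y))[y0 yk].
by rewrite ff'.
Qed.

Lemma earring_snd_eq0 (p : RR * RR) : p.2 = 0 -> earring p -> p = 0.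
Proof. by move=> p2 /earring_snd0 ->. Qed.

Definition keep (P : pred RR) (p : RR * RR) : RR * RR := if P (kappa p) then p else 0.

Lemma keep_cases P p : keep P p = p \/ keep P p = 0.
Proof. by rewrite /keep; case: ifP; [left|right]. Qed.

Lemma keep_cloop P g : cloop g -> cloop (keep P \o g).
Proof.
move=> [cg Eg g0 g1]; split.
- apply: (continuous_circlewise cg Eg) => [x|x gx].
    rewrite /=; case: (keep_cases P (g x)) => -> //.
    by rewrite /sqn/= expr0n/= addr0 addr_ge0 ?sqr_ge0.
  rewrite /= /keep; case: ifP => Px.
    by exists g => [|y gy ->]; [exact: cg|rewrite Px].
  by exists (fun=> 0) => [|y gy ->]; [exact: cvg_cst|rewrite Px].
- by move=> t /=; case: (keep_cases P (g t)) => -> //; exact: earring_origin.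
- by move=> t /g0 /= ->; rewrite /keep; case: ifP.
- by move=> t /g1 /= ->; rewrite /keep; case: ifP.
Qed.

(** Off the origin, [kappa] is the index of the only circle through a point of the earring. *)
Lemma retractNE N p : earring p -> retractN N p = keep (fun c => c <= N%:R) p.
Proof.
move=> Ep; rewrite /retractN /keep; have [p2|p2] := eqVneq p.2 0.
  by rewrite (earring_snd_eq0 p2 Ep); case: asboolP; case: ifP.
have [n n0 pn] := earring_kappa Ep p2.
have pcirc m : (0 < m)%N -> circle m p <-> m = n.
  move=> m0; rewrite circle_kappa// pn; split=> [/eqP|->//].
  by rewrite eqr_nat => /eqP.
rewrite pn ler_nat; case: asboolP => [[m [/andP[m0 mN] /(pcirc m m0) <-]]|nm].
  by rewrite mN.
case: ifP => // nN; exfalso; apply: nm; exists n; split; first by rewrite n0.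
exact/pcirc.
Qed.

(* On each circle of index at most [N] the deformation [squeeze N s] collapses, at
   [s = 1], the lower half-circle [p.2 <= |p.1|] to the origin. *)
Definition squeeze (N : nat) (s : RR) (p : RR * RR) : RR * RR :=
  if kappa p <= N%:R then ray (kappa p) (p.1, Num.max 0 (p.2 - `|s| * `|p.1|)) else p.

Lemma push_continuous (R : realType) :
  continuous (fun x : R * (R * R) => (x.2.1, Num.max 0 (x.2.2 - `|x.1| * `|x.2.1|))).
Proof.
move=> x.
have c0 : fst w @[w --> x] --> x.1 by exact: cvg_fst.
have c1 : w.2.1 @[w --> x] --> x.2.1.
  by apply: (@cvg_comp _ _ _ snd fst (nbhs x) (nbhs x.2)); [exact: cvg_snd|exact: cvg_fst].
have c2 : w.2.2 @[w --> x] --> x.2.2.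
  by apply: (@cvg_comp _ _ _ snd snd (nbhs x) (nbhs x.2)); [exact: cvg_snd|exact: cvg_snd].
have cB : w.2.2 - `|w.1| * `|w.2.1| @[w --> x] --> x.2.2 - `|x.1| * `|x.2.1|.
  by apply: cvgB => //; apply: cvgM; exact: cvg_norm.
apply: (cvg_pair (G := nbhs x.2.1) (H := nbhs (Num.max 0 (x.2.2 - `|x.1| * `|x.2.1|)))) => //.
have C0 : (fun=> 0 : R) w @[w --> x] --> (0 : R) by exact: cvg_cst.
exact: (continuous_max C0 cB).
Qed.

Lemma sqn_ray (R : realType) (k : R) v : 0 < k -> 0 < sqn v ->
  sqn (ray k v) = 4 * v.2 ^+ 2 / (k ^+ 2 * sqn v).
Proof.
rewrite /sqn => k0 v0; rewrite /ray/=; field.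
by rewrite !gt_eqF.
Qed.

Lemma squeeze_earring N s p : earring p -> earring (squeeze N s p).
Proof.
move=> Ep; rewrite /squeeze; case: ifP => // _.
have [p2|p2] := eqVneq p.2 0; last by have [n n0 ->] := earring_kappa Ep p2; exact: ray_earring.
rewrite (earring_snd_eq0 p2 Ep) /= ray_snd0/=; first exact: earring_origin.
by rewrite normr0 mulr0 subrr maxxx.
Qed.

Lemma squeeze0 N s : squeeze N s 0 = 0.
Proof.
rewrite /squeeze; case: ifP => // _; rewrite ray_snd0//=.
by rewrite normr0 mulr0 subrr maxxx.
Qed.

Lemma push_bounds (s : RR) (p : RR * RR) : earring p ->
  0 <= Num.max 0 (p.2 - `|s| * `|p.1|) <= p.2.
Proof.
move=> Ep; rewrite le_max lexx/= ge_max (earring_ge0 Ep)/=.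
by rewrite lerBlDr lerDl mulr_ge0.
Qed.

(** On a circle the distance from the origin grows with the steepness of the direction, and
    [squeeze] lowers the direction. This bound yields continuity at the origin. *)
Lemma squeeze_sqn N s p : earring p -> sqn (squeeze N s p) <= sqn p.
Proof.
move=> Ep; have [p2|p2] := eqVneq p.2 0.
  by rewrite (earring_snd_eq0 p2 Ep) squeeze0.
rewrite /squeeze; case: ifP => // _.
have [n n0 pn] := earring_kappa Ep p2.
have [b0 bp] := andP (push_bounds s Ep); set b := Num.max 0 _ in b0 bp *.
have [->|bn0] := eqVneq b 0.
  by rewrite ray_snd0// /sqn/= expr0n/= addr0 addr_ge0 ?sqr_ge0.
have bgt : 0 < b by rewrite lt_neqAle eq_sym bn0.
have pgt : 0 < p.2 by exact: lt_le_trans bp.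
have q0 : 0 < sqn p by exact: sqr_sum_gt0.
have v0 : 0 < sqn (p.1, b) by exact: (@sqr_sum_gt0 (p.1, b)).
rewrite sqn_ray//; last by rewrite /kappa divr_gt0// mulr_gt0.
rewrite /kappa -/(sqn p) /=.
rewrite (_ : _ / _ = sqn p * ((b ^+ 2 * sqn p) / (p.2 ^+ 2 * sqn (p.1, b)))); last first.
  by field; rewrite !gt_eqF.
rewrite -[leRHS]mulr1 ler_pM2l// ler_pdivrMr ?mul1r; last by rewrite mulr_gt0// exprn_gt0.
rewrite /sqn/= !mulrDr [p.2 ^+ 2 * b ^+ 2]mulrC lerD2r ler_wpM2r ?sqr_ge0//.
by rewrite ler_sqr ?nnegrE// ltW.
Qed.

Lemma squeeze_continuous N (X : topologicalType) (s : X -> RR) (g : X -> RR * RR) :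
  continuous s -> continuous g -> (forall x, earring (g x)) ->
  continuous (fun x => squeeze N (s x) (g x)).
Proof.
move=> cs cg Eg; apply: (continuous_circlewise cg Eg) => [x|x gx].
  exact: squeeze_sqn.
have [n n0 gn] := earring_kappa (Eg x) gx.
rewrite /squeeze; case: ifP => gN; last by exists g => [|y gy ->]; [exact: cg|rewrite gN].
pose v (y : X) := ((g y).1, Num.max 0 ((g y).2 - `|s y| * `|(g y).1|)).
exists (fun y => ray (kappa (g x)) (v y)); last first.
  by move=> y gy ->; rewrite gN.
apply: (@cvg_comp _ _ _ v (ray (kappa (g x))) (nbhs x) (nbhs (v x))).
  apply: (@cvg_comp _ _ _ (fun y => (s y, g y))
      (fun w : RR * (RR * RR) => (w.2.1, Num.max 0 (w.2.2 - `|w.1| * `|w.2.1|)))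
      (nbhs x) (nbhs (s x, g x))).
    by apply: (cvg_pair (G := nbhs (s x)) (H := nbhs (g x))); [exact: cs|exact: cg].
  exact: (@push_continuous RR (s x, g x)).
apply: ray_cvg; first by rewrite gn ltr0n.
(* The pushed direction is never zero: on the vertical axis nothing is subtracted from the positive
   height. *)
apply/eqP => -[g1]; rewrite g1 normr0 mulr0 subr0 max_r ?earring_ge0// => /eqP.
by rewrite (negPf gx).
Qed.

Lemma squeeze_id N p : earring p -> squeeze N 0 p = p.
Proof.
move=> Ep; rewrite /squeeze; case: ifP => // _.
rewrite normr0 mul0r subr0 max_r ?earring_ge0// -surjective_pairing.
have [p2|p2] := eqVneq p.2 0; first by rewrite (earring_snd_eq0 p2 Ep) ray_snd0.
have q0 := sqr_sum_gt0 p2; rewrite [RHS]surjective_pairing /ray /kappa.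
by congr pair; field; rewrite p2 gt_eqF.
Qed.

Lemma squeeze_cloop N s g : cloop g -> cloop (squeeze N s \o g).
Proof.
move=> [cg Eg g0 g1]; split.
- by apply: (squeeze_continuous (s := fun=> s)) => // x; exact: cvg_cst.
- by move=> t; exact: squeeze_earring.
- by move=> t /g0 /= ->; rewrite squeeze0.
- by move=> t /g1 /= ->; rewrite squeeze0.
Qed.

(** A squeezed point either stays on its circle or becomes the origin. *)
Lemma keep_squeeze N s P p : earring p -> keep P (squeeze N s p) = squeeze N s (keep P p).
Proof.
move=> Ep; have [p2|p2] := eqVneq p.2 0.
  by rewrite (earring_snd_eq0 p2 Ep) squeeze0 /keep; case: ifP; rewrite squeeze0.
have [n n0 pn] := earring_kappa Ep p2.
have [k0|] : squeeze N s p = 0 \/ kappa (squeeze N s p) = kappa p.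
  rewrite /squeeze; case: ifP => _; last by right.
  set v := (p.1, _); have [v2|v2] := eqVneq v.2 0; first by left; exact: ray_snd0.
  right; rewrite pn; apply/(circle_kappa n0); last exact: ray_circle.
  by rewrite gt_eqF// ray_snd_gt0.
  rewrite k0 {1}/keep; case: (keep_cases P p) => ->; rewrite ?squeeze0 ?k0; by case: ifP.
by rewrite /keep => ->; case: ifP => //; rewrite squeeze0.
Qed.

(** * Splitting off the first [N] circles *)

Definition le_idx (N : nat) : pred RR := fun c => c <= N%:R.
Definition gt_idx (N : nat) : pred RR := fun c => N%:R < c.

Section Decomposition.
Variables (A : zmodType) (phi : (RR -> RR * RR) -> A).
Hypothesis phi_homotopic : forall a b, loop a -> loop b -> loop_homotopic a b -> phi a = phi b.
Hypothesis phi_concat : forall a b, loop a -> loop b -> phi (loop_concat a b) = phi a + phi b.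

Lemma phi_squeeze N g : cloop g -> phi g = phi (squeeze N 1 \o g).
Proof.
move=> lg; have [cg Eg g0 g1] := lg.
apply: (phi_homotopy phi_homotopic (H := fun x => squeeze N x.1 (g x.2))).
- exact: cloop_loop.
- exact/cloop_loop/squeeze_cloop.
- apply: (squeeze_continuous (s := fst) (g := g \o snd)) => [x|x|x].
  + exact: cvg_fst.
  + apply: (@cvg_comp _ _ _ snd g (nbhs x) (nbhs x.2)); first exact: cvg_snd.
    exact: cg.
  + exact: Eg.
- by move=> x; exact/squeeze_earring.
- by move=> t t01 /=; rewrite squeeze_id.
- by move=> s; rewrite /= g0// g1// squeeze0.
Qed.

(** On a circle of index [n] at most [N], a height below [1/(N+1)] is below the centre height [1/n].
    Such a point lies in the lower half, which [squeeze N 1] collapses. *)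
Lemma squeeze_near0 N p : earring p -> p.2 < N.+1%:R^-1 -> keep (le_idx N) (squeeze N 1 p) = 0.
Proof.
move=> Ep pN; have [p2|p2] := eqVneq p.2 0.
  by rewrite (earring_snd_eq0 p2 Ep) squeeze0 /keep; case: ifP.
have [n n0 pn] := earring_kappa Ep p2.
rewrite keep_squeeze// /keep /le_idx; case: ifP => nN; last exact: squeeze0.
rewrite /squeeze nN ray_snd0//= normr1 mul1r; apply/max_idPl; rewrite subr_le0.
have pgt : 0 < p.2 by rewrite lt_neqAle eq_sym p2 earring_ge0.
rewrite -(@ler_pXn2r _ 2) ?nnegrE ?(ltW pgt)// real_normK ?num_real//.
have /(circle_kappa n0 p2)/(circleE _ n0) E := pn.
have pn1 : n%:R * p.2 <= 1.
  move: pN; rewrite -[_^-1]mul1r ltr_pdivlMr ?ltr0n// => /ltW; apply: le_trans.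
  rewrite mulrC ler_pM2l// ler_nat leqW// -(ler_nat RR) -pn.
  exact: nN.
have nR : (0 : RR) < n%:R by rewrite ltr0n.
by rewrite -(ler_pM2l nR); nra.
Qed.

(** Squeezing changes no value of [phi] and commutes with [keep]. Afterwards the part in the first
    [N] circles vanishes near each time when [g] is at the origin; near any other time [g] stays on
    one circle, so one of the two parts vanishes. *)
Lemma phi_split N g : cloop g ->
  phi g = phi (keep (le_idx N) \o g) + phi (keep (gt_idx N) \o g).
Proof.
move=> lg; have [cg Eg g0 g1] := lg.
rewrite (phi_squeeze N lg) (phi_squeeze N (keep_cloop (le_idx N) lg))
  (phi_squeeze N (keep_cloop (gt_idx N) lg)).
have comm P : squeeze N 1 \o (keep P \o g) = keep P \o (squeeze N 1 \o g).
  by apply/funext => t; rewrite /= keep_squeeze.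
rewrite !comm; have lsg := squeeze_cloop N 1 lg.
apply: (phi_disjoint_sum phi_homotopic phi_concat) => //; try exact: keep_cloop.
  move=> t /=; rewrite /keep /le_idx /gt_idx ltNge; case: ifP => _ /=.
    by rewrite addr0.
  by rewrite add0r.
move=> t; have [gt2|gt2] := eqVneq (g t).2 0.
  exists (g @^-1` [set p | p.2 < N.+1%:R^-1]).
    by apply: cg; apply: near_snd_lt; rewrite gt2 invr_gt0 ltr0n.
  by left => t' /= gt'; exact: squeeze_near0.
exists (g @^-1` [set p | earring p -> p.2 != 0 /\ kappa p = kappa (g t)]).
  by apply: cg; exact: near_earring_kappa.
have [gN|gN] := boolP (kappa (g t) <= N%:R).
  right => t' /= /(_ (Eg t'))[_ kt]; rewrite keep_squeeze// /keep /gt_idx kt.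
  by rewrite ltNge gN squeeze0.
left => t' /= /(_ (Eg t'))[_ kt]; rewrite keep_squeeze// /keep /le_idx kt.
by rewrite (negPf gN) squeeze0.
Qed.

Fixpoint lpow (y : RR -> RR * RR) (m : nat) : RR -> RR * RR :=
  if m is m'.+1 then loop_concat y (lpow y m') else fun=> 0.

Lemma cloop0 : cloop (fun=> 0).
Proof. by split=> // t; [exact: cvg_cst|exact: earring_origin]. Qed.

Lemma lpow_cloop y m : cloop y -> cloop (lpow y m).
Proof. by move=> ly; elim: m => [|m IH]; [exact: cloop0|exact: concat_cloop]. Qed.

Lemma phi_lpow y m : cloop y -> phi (lpow y m) = phi y *+ m.
Proof.
move=> ly; elim: m => [|m IH]; first exact: phi0.
by rewrite /= phi_concat ?IH ?mulrS//; apply: cloop_loop => //; exact: lpow_cloop.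
Qed.

End Decomposition.

(** * Infinite concatenations *)

Lemma concat_ind (P : RR * RR -> Prop) a b : (forall t, P (a t)) -> (forall t, P (b t)) ->
  forall t, P (loop_concat a b t).
Proof. by move=> Pa Pb t; rewrite /loop_concat; case: ifP. Qed.

Lemma concat_ind2 (P : RR * RR -> RR * RR -> Prop) a b a' b' : (forall t, P (a t) (a' t)) ->
  (forall t, P (b t) (b' t)) -> forall t, P (loop_concat a b t) (loop_concat a' b' t).
Proof. by move=> Pa Pb t; rewrite /loop_concat; case: ifP. Qed.

Lemma lpow_ind (P : RR * RR -> Prop) y m : P 0 -> (forall t, P (y t)) -> forall t, P (lpow y m t).
Proof. by move=> P0 Py; elim: m => [//|m IH]; exact: concat_ind. Qed.

Lemma lpow_ind2 (P : RR * RR -> RR * RR -> Prop) y y' m : P 0 0 -> (forall t, P (y t) (y' t)) ->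
  forall t, P (lpow y m t) (lpow y' m t).
Proof. by move=> P0 Py; elim: m => [//|m IH]; exact: concat_ind2. Qed.

Definition close (r : RR) (p q : RR * RR) : Prop := `|p.1 - q.1| <= r /\ `|p.2 - q.2| <= r.

(* The limit is [sup_k (u k - c k)]. *)
Lemma nested_limit (u c : nat -> RR) : (forall k l, (k <= l)%N -> `|u k - u l| <= c k) ->
  (forall k l, (k <= l)%N -> c l <= c k) -> exists p, forall k, `|u k - p| <= c k.
Proof.
move=> uc cc; pose D := [set u k - c k | k in [set: nat]].
have ucl k l : u k - c k <= u l + c l.
  have [kl|/ltnW lk] := leqP k l.
    have := uc _ _ kl; rewrite ler_norml => /andP[? ?].
    have := le_trans (normr_ge0 _) (uc l l (leqnn l)); lra.
  have := uc _ _ lk; rewrite ler_norml => /andP[? ?].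
  have := le_trans (normr_ge0 _) (uc k k (leqnn k)); lra.
have D0 : D !=set0 by exists (u 0%N - c 0%N); exists 0%N.
exists (sup D) => k; rewrite ler_distlC; apply/andP; split; last first.
  by apply: ge_sup => // _ [l _ <-]; exact: ucl.
by apply: ub_le_sup; [exists (u 0%N + c 0%N) => _ [l _ <-]|exists k].
Qed.

Lemma continuous_uniform_approx (R : realType) (X : topologicalType) (f : X -> R) :
  (forall eps, 0 < eps -> exists2 u : X -> R, continuous u &
     forall t, `|u t - f t| <= eps) -> continuous f.
Proof.
move=> fu t; apply/cvgrPdist_lt => eps eps0.
have e4 : 0 < eps / 4 by rewrite divr_gt0.
have [u cu uf] := fu _ e4.
have := cu t; move/cvgrPdist_lt => /(_ _ e4).
apply: filterS => s; rewrite ltr_norml => /andP[? ?].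
have := uf t; have := uf s; rewrite !ler_norml => /andP[? ?] /andP[? ?].
by rewrite ltr_norml; apply/andP; split; lra.
Qed.

Lemma continuous_fst_comp (R : realType) (X : topologicalType) (f : X -> R * R) :
  continuous f -> continuous (fun t => (f t).1).
Proof.
by move=> cf t; apply: (@cvg_comp _ _ _ f fst _ (nbhs (f t))); [exact: cf|exact: cvg_fst].
Qed.

Lemma continuous_snd_comp (R : realType) (X : topologicalType) (f : X -> R * R) :
  continuous f -> continuous (fun t => (f t).2).
Proof.
by move=> cf t; apply: (@cvg_comp _ _ _ f snd _ (nbhs (f t))); [exact: cf|exact: cvg_snd].
Qed.

Section InfiniteConcatenation.
Variables (h : nat -> RR -> RR * RR) (m : nat -> nat).
Hypothesis lh : forall n, cloop (h n).
Hypothesis h_small : forall n t, close (2 / n.+1%:R) (h n t) 0.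

Definition branch_loop (e : nat -> bool) n (y : RR -> RR * RR) : RR -> RR * RR :=
  loop_concat (if e n then h n else fun=> 0) (lpow y (m n)).

Lemma branch_cloop e n y : cloop y -> cloop (branch_loop e n y).
Proof.
move=> ly; apply: concat_cloop; last exact: lpow_cloop.
by case: (e n) => //; exact: cloop0.
Qed.

(** The infinite concatenation from level [n] on, cut off after [k] levels by the constant loop. *)
Fixpoint approx (e : nat -> bool) (n k : nat) : RR -> RR * RR :=
  if k is k'.+1 then branch_loop e n (approx e n.+1 k') else fun=> 0.

Lemma approx_cloop e n k : cloop (approx e n k).
Proof. by elim: k n => [|k IH] n; [exact: cloop0|exact: branch_cloop]. Qed.

Lemma close_refl r p : 0 <= r -> close r p p.
Proof. by rewrite /close !subrr normr0. Qed.

Lemma closeC r p q : close r p q -> close r q p.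
Proof. by move=> [? ?]; split; rewrite distrC. Qed.

Lemma close_le r r' p q : r <= r' -> close r p q -> close r' p q.
Proof. by move=> rr [p1 p2]; split; exact: le_trans rr. Qed.

Lemma close_trans r r' p q q' : close r p q -> close r' q q' -> close (r + r') p q'.
Proof.
move=> [p1 p2] [q1 q2]; split.
  by apply: le_trans (ler_distD q.1 _ _) _; exact: lerD.
by apply: le_trans (ler_distD q.2 _ _) _; exact: lerD.
Qed.

Lemma rad_ge0 n : 0 <= 2 / n.+1%:R :> RR.
Proof. by rewrite divr_ge0. Qed.

Lemma rad_le n k : (n <= k)%N -> 2 / k.+1%:R <= 2 / n.+1%:R :> RR.
Proof. by move=> nk; rewrite ler_pM2l// lef_pV2 ?posrE ?ltr0n// ler_nat. Qed.

Lemma rad_small (r : RR) n : 0 < r -> exists k, 2 / (n + k).+1%:R < r.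
Proof.
move=> r0; have r20 : 0 < r / 2 by rewrite divr_gt0.
have [k kr] := invS_lt r20; exists k; rewrite mulrC -ltr_pdivlMr//.
apply: le_lt_trans kr; rewrite lef_pV2 ?posrE ?ltr0n// ler_nat.
by rewrite ltnS leq_addl.
Qed.

Lemma approx_small e n k t : close (2 / n.+1%:R) (approx e n k t) 0.
Proof.
elim: k n t => [|k IH] n t; first exact/close_refl/rad_ge0.
apply: (@concat_ind (fun p => close (2 / n.+1%:R) p 0)) => {}t.
  by case: (e n); [exact: h_small|exact/close_refl/rad_ge0].
apply: (@lpow_ind (fun p => close (2 / n.+1%:R) p 0)); first exact/close_refl/rad_ge0.
by move=> {}t; apply: close_le (IH n.+1 t); exact: rad_le.
Qed.

(** At each time a concatenation evaluates only one factor, so uniform errors are not multiplied by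
    the exponent [m n]. *)
Lemma branch_close e n y y' r : 0 <= r -> (forall t, close r (y t) (y' t)) ->
  forall t, close r (branch_loop e n y t) (branch_loop e n y' t).
Proof.
move=> r0 yy; apply: concat_ind2 => [t|]; first exact: close_refl.
by apply: lpow_ind2 => //; exact: close_refl.
Qed.

Lemma approx_cauchy e n k l t : (k <= l)%N ->
  close (2 / (n + k).+1%:R) (approx e n k t) (approx e n l t).
Proof.
elim: k n l t => [|k IH] n l t; first by move=> _; rewrite addn0; exact/closeC/approx_small.
case: l => // l; rewrite ltnS => kl /=; apply: branch_close; first exact: rad_ge0.
by move=> {}t; rewrite addnS -addSn; exact: IH.
Qed.

Lemma infinite_loop_ex (en : (nat -> bool) * nat) : exists y : RR -> RR * RR, forall t k,
  close (2 / (en.2 + k).+1%:R) (approx en.1 en.2 k t) (y t).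
Proof.
case: en => e n /=; have yP t : exists p, forall k, close (2 / (n + k).+1%:R) (approx e n k t) p.
  have cc k l : (k <= l)%N -> 2 / (n + l).+1%:R <= 2 / (n + k).+1%:R :> RR.
    by move=> kl; apply: rad_le; rewrite leq_add2l.
  have [|p1 p1P] := @nested_limit (fun k => (approx e n k t).1) (fun k => 2 / (n + k).+1%:R) _ cc.
    by move=> k l kl; have [] := @approx_cauchy e n k l t kl.
  have [|p2 p2P] := @nested_limit (fun k => (approx e n k t).2) (fun k => 2 / (n + k).+1%:R) _ cc.
    by move=> k l kl; have [] := @approx_cauchy e n k l t kl.
  by exists (p1, p2) => k; split; [exact: p1P|exact: p2P].
by have [y yP'] := choice yP; exists y => t k; exact: yP'.
Qed.

Lemma close_eq p q n c : (0 < c) -> (forall k, close (c * (2 / (n + k).+1%:R)) p q) -> p = q.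
Proof.
move=> c0 pq; have coord (a b : RR) : (forall k, `|a - b| <= c * (2 / (n + k).+1%:R)) -> a = b.
  move=> ab; apply/eqP; rewrite -subr_eq0 -normr_le0 leNgt; apply/negP => d0.
  have d0' : 0 < `|a - b| / c by rewrite divr_gt0.
  have [k] := rad_small n d0'; rewrite ltr_pdivlMr// mulrC ltNge => /negP; apply.
  exact: ab.
rewrite [p]surjective_pairing [q]surjective_pairing.
by congr pair; apply: coord => k; have [] := pq k.
Qed.

(** The loops are uniform limits of [approx], and the recursion passes to the limit because
    [branch_loop] does not increase uniform distances. *)
Lemma infinite_loops : exists y : (nat -> bool) -> nat -> RR -> RR * RR,
  forall e n, cloop (y e n) /\ y e n = branch_loop e n (y e n.+1).
Proof.
have [y0 y0P] := choice infinite_loop_ex; pose y e n := y0 (e, n).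
have yP e n t k : close (2 / (n + k).+1%:R) (approx e n k t) (y e n t).
  exact: (y0P (e, n)).
have yE e n : y e n = branch_loop e n (y e n.+1).
  (* The factor 2 comes from the triangle inequality through [approx e n k.+1]. *)
  apply/funext => t; apply: (@close_eq _ _ n 2) => // k.
  have c1 := closeC (yP e n t k.+1).
  have c2 : close (2 / (n.+1 + k).+1%:R) (approx e n k.+1 t) (branch_loop e n (y e n.+1) t).
    by apply: branch_close => [|s]; [exact: rad_ge0|exact: yP].
  rewrite (_ : 2 * (2 / (n + k).+1%:R) = 2 / (n + k).+1%:R + 2 / (n + k).+1%:R);
    last by rewrite mulr_natl mulr2n.
  apply: (@close_trans _ _ _ (approx e n k.+1 t)).
    by apply: close_le c1; apply: rad_le; rewrite addnS.
  by apply: close_le c2; apply: rad_le; rewrite addSn.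
have y_close0 e n t : close (2 / n.+1%:R) (y e n t) 0.
  by apply: closeC; have := yP e n t 0%N; rewrite addn0.
exists y => e n; split=> //; split.
- have c1 : continuous (fun t : RR => (y e n t).1).
    apply: (@continuous_uniform_approx RR) => r /(rad_small n)[k kr].
    exists (fun t => (approx e n k t).1); first by apply: continuous_fst_comp; case: (approx_cloop e n k).
    by move=> t; apply: le_trans (ltW kr); case: (yP e n t k).
  have c2 : continuous (fun t : RR => (y e n t).2).
    apply: (@continuous_uniform_approx RR) => r /(rad_small n)[k kr].
    exists (fun t => (approx e n k t).2); first by apply: continuous_snd_comp; case: (approx_cloop e n k).
    by move=> t; apply: le_trans (ltW kr); case: (yP e n t k).
  move=> t; have C := @cvg_pair _ _ _ (nbhs t) (nbhs (y e n t).1) (nbhs (y e n t).2) _ _ _ _ _ (c1 t) (c2 t).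
  have E : (fun s => ((y e n s).1, (y e n s).2)) = y e n.
    by apply/funext => s; rewrite -surjective_pairing.
  rewrite E in C.
  by rewrite /continuous_at [y e n t]surjective_pairing; exact: C.
- move=> t.
  (* Unrolling the recursion [k] times gives a point of the constant loop or of some [h i], or else
     a value of a level [k] steps deeper, which is close to the origin. *)
  have descent k j s : earring (y e j s) \/ close (2 / (j + k).+1%:R) (y e j s) 0.
    elim: k j s => [|k IH] j s; first by right; rewrite addn0.
    pose P p := earring p \/ close (2 / (j + k.+1).+1%:R) p 0.
    rewrite yE; apply: (@concat_ind P) => {}s.
      left; case: (e j); last exact: earring_origin.
      by have [] := lh j.
    apply: (@lpow_ind P) => [|{}s]; first by left; exact: earring_origin.
    by rewrite /P addnS -addSn; exact: IH.
  have [//|nE] := pselect (earring (y e n t)).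
  suff -> : y e n t = 0 by exact: earring_origin.
  apply: (@close_eq _ _ n 1) => // k; rewrite mul1r.
  by have [] := descent k n t.
- move=> t t0; apply: (@close_eq _ _ n 1) => // k; rewrite mul1r; apply: closeC.
  by have := yP e n t k; have [_ _ -> //] := approx_cloop e n k.
- move=> t t0; apply: (@close_eq _ _ n 1) => // k; rewrite mul1r; apply: closeC.
  by have := yP e n t k; have [_ _ _ -> //] := approx_cloop e n k.
Qed.
End InfiniteConcatenation.

(** * Torsion-free reduced groups and n-slenderness *)

Lemma keep_gt_close N p : earring p -> close (2 / N.+1%:R) (keep (gt_idx N) p) 0.
Proof.
move=> Ep; have [p2|p2] := eqVneq p.2 0.
  by rewrite (earring_snd_eq0 p2 Ep) /keep; case: ifP => _; exact/close_refl/rad_ge0.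
rewrite /keep /gt_idx; case: ifP => [Np|_]; last exact/close_refl/rad_ge0.
have [n n0 pn] := earring_kappa Ep p2; rewrite pn ltr_nat in Np.
have /(circle_kappa n0 p2)/(circleE _ n0) E := pn.
have q0 : 0 < p.1 ^+ 2 + p.2 ^+ 2 by exact: sqr_sum_gt0.
have nR : (0 : RR) < n%:R by rewrite ltr0n.
(* The circle of index [n] has diameter [2 / n]. *)
have bound : (p.1 ^+ 2 + p.2 ^+ 2) * n%:R ^+ 2 <= 4.
  rewrite -(ler_pM2l q0) (_ : _ * (_ * _) = (n%:R * (p.1 ^+ 2 + p.2 ^+ 2)) ^+ 2); last by ring.
  by rewrite E exprMn; have := sqr_ge0 p.1; nra.
have {}bound : p.1 ^+ 2 + p.2 ^+ 2 <= (2 / N.+1%:R) ^+ 2.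
  rewrite expr_div_n -natrX ler_pdivlMr ?exprn_gt0//; apply: le_trans bound.
  by rewrite ler_pM2l// lerXn2r ?nnegrE// ler_nat.
split; rewrite subr0 -(@ler_pXn2r _ 2) ?nnegrE ?rad_ge0// real_normK ?num_real//;
  apply: le_trans bound.
  by rewrite lerDl sqr_ge0.
by rewrite lerDr sqr_ge0.
Qed.

Lemma tfr_nslender (A : zmodType) : torsion_free_reduced A ->
  ~ card_le [set: nat -> bool] [set: A] -> nslender A.
Proof.
move=> tA cA phi phi_h phi_c; apply: contrapT => nN.
have hP N : exists h, [/\ cloop h, forall t, close (2 / N.+1%:R) (h t) 0 & phi h <> 0].
  have [g lg gN] : exists2 g, loop g & phi g <> phi (retractN N \o g).
    apply: contrapT => ng; apply: nN; exists N => g lg.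
    by apply: contrapT => gN; apply: ng; exists g.
  (* Replacing [g] by its clamped extension changes neither value of [phi]. By [phi_split], these
     values differ by that of the part beyond circle [N]. *)
  have lG := clamp_cloop lg; set G := g \o _ in lG.
  have gG t : I01 t -> g t = G t by move=> t01; rewrite /G/= clamp_id.
  have phi_g : phi g = phi G by exact: (eq_phi phi_h).
  have phi_rg : phi (retractN N \o g) = phi (keep (le_idx N) \o G).
    symmetry; apply: (eq_phi phi_h); first exact/cloop_loop/keep_cloop.
    by move=> t t01; rewrite /= -gG// retractNE//; case: lg => _ [+ _]; exact.
  exists (keep (gt_idx N) \o G); split.
  - exact: keep_cloop.
  - by move=> t; apply: keep_gt_close; case: lG.
  - move=> h0; apply: gN; rewrite phi_g phi_rg (phi_split phi_h phi_c N lG) h0.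
    by rewrite addr0.
have [h /all_and3[lh h_small h0]] := choice hP.
have mP n : exists m, (0 < m)%N /\ forall b, phi (h n) <> b *+ m.
  by have [_ /(_ _ (h0 n))[m m0 mb]] := tA; exists m.
have [m /all_and2[m0 hm]] := choice mP.
have [y yP] := infinite_loops m lh h_small.
apply: (no_branching tA cA m0 hm (F := fun e n => phi (y e n))) => e n.
have [ly yE] := yP e n; have [lyS _] := yP e n.+1.
rewrite {1}yE /branch_loop phi_c; last 2 first.
- by apply: cloop_loop; case: (e n) => //; exact: cloop0.
- exact/cloop_loop/lpow_cloop.
rewrite (phi_lpow phi_c)//; congr (_ + _).
by case: (e n) => //; exact: (phi0 phi_c).
Qed.

Theorem theoremC (A : zmodType) :
  card_lt_continuum A ->
  (slender A <-> nslender A) /\ (slender A <-> cmslender A) /\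
  (slender A <-> lcHslender A).
Proof.
move=> [_ cA]; have sl : slender A <-> torsion_free_reduced A.
  by split=> [/slender_tfr|/tfr_slender] //; exact.
split; last split; split.
- by move=> /sl/tfr_nslender; exact.
- by move=> /nslender_tfr/sl.
- by move=> /sl/tfr_cmslender; exact.
- by move=> /cmslender_tfr/sl.
- by move=> /sl/tfr_lcHslender; exact.
- by move=> /lcHslender_tfr/sl.
Qed.
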